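(* Let $X$ be a Peano continuum with uncountably many local cut points. Then $X$ is a topological fractal and its witnessing number is at most three.
   Context: A continuum is a nonempty connected compact metrizable space; a Peano continuum is a locally connected continuum. A point $x$ of a topological space $X$ is a local cut point of $X$ if there exists a connected neighborhood $U$ of $x$ such that $U\setminus\{x\}$ is not connected. For a set $\mathcal F$ of self-maps of a set $X$ put $\mathcal F^0=\{\mathrm{id}\}$ and, for $n>0$, $\mathcal F^n=\{f_1\circ\dots\circ f_n : f_i\in\mathcal F \text{ for } 1\le i\le n\}$. If $X$ is a metric space, $\mathcal F$ is called topologically contractive if for every $\varepsilon>0$ there exists $k\in\mathbb N$ such that $\operatorname{diam} f(X)<\varepsilon$ for every $f\in\mathcal F^k$ (for compact $X$ this does not depend on the choice of compatible metric). A compact metric (or metrizable, with any compatible metric) space $X$ is a topological fractal if there exists a finite topologically contractive set $\mathcal F$ of continuous self-maps of $X$ with $\bigcup\{f(X): f\in\mathcal F\}=X$. The maps in such an $\mathcal F$ are called witnessing maps, and the smallest cardinality of such a family $\mathcal F$ is called the witnessing number of $X$. *)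

(* Defs.v *)
From mathcomp Require Import all_boot all_order all_algebra.
From mathcomp Require Import all_classical all_reals.
From mathcomp Require Import topology ereal.

Set Implicit Arguments.
Unset Strict Implicit.
Unset Printing Implicit Defensive.

Import Order.TTheory GRing.Theory Num.Theory.
Local Open Scope classical_set_scope.
Local Open Scope ring_scope.

Definition locally_connected (T : topologicalType) : Prop :=
  forall (x : T) (U : set T), nbhs x U ->
    exists V : set T, [/\ open V, V x, connected V & V `<=` U].

(* The neighborhood [U] need not be open. *)
Definition local_cut_point (T : topologicalType) (x : T) : Prop :=
  exists U : set T, [/\ nbhs x U, connected U & ~ connected (U `\ x)].

(* A metrizable space is represented by a [metricType], i.e. together with an
   arbitrary compatible metric; for compact spaces none of the notions below
   depends on which one. *)
Definition continuum (R : realType) (X : metricType R) : Prop :=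
  [/\ [set: X] !=set0, connected [set: X] & compact [set: X]].

Definition peano_continuum (R : realType) (X : metricType R) : Prop :=
  continuum X /\ locally_connected X.

(* [ereal_sup], unlike the real [sup], does not collapse to 0 on unbounded
   sets; the diameter of the empty set is -oo. *)
Definition diameter (R : realType) (X : metricType R) (A : set X) : \bar R :=
  ereal_sup [set (mdist z.1 z.2)%:E | z in A `*` A].

(* All composites [s 0 \o s 1 \o ... \o s (n - 1)] with factors in [F]; for
   [n = 0] the empty composite is the identity. *)
Definition iter_maps (T : Type) (F : set (T -> T)) (n : nat) : set (T -> T) :=
  [set \big[@comp T T T/id]_(i < n) s i |
     s in [set s : 'I_n -> T -> T | forall i, F (s i)]].

Definition topologically_contractive (R : realType) (X : metricType R)
    (F : set (X -> X)) : Prop :=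
  forall e : R, 0 < e ->
    exists k : nat, forall f, iter_maps F k f -> (diameter (range f) < e%:E)%E.

Definition witnessing_family (R : realType) (X : metricType R)
    (F : set (X -> X)) : Prop :=
  [/\ finite_set F, (forall f, F f -> continuous f),
      topologically_contractive F & \bigcup_(f in F) range f = [set: X]].

Definition topological_fractal (R : realType) (X : metricType R) : Prop :=
  compact [set: X] /\ exists F : set (X -> X), witnessing_family F.

Definition is_witnessing_number (R : realType) (X : metricType R) (n : nat) :
    Prop :=
  (exists2 F : set (X -> X), witnessing_family F & (F #= `I_n)%card) /\
  (forall (F : set (X -> X)) (m : nat),
     witnessing_family F -> (F #= `I_m)%card -> (n <= m)%N).

(* Main.v *)
(* Some connected open set [V] contains two points [a], [b] separated in [V] by
   uncountably many points, and these separating points are linearly ordered.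
   A dense-in-itself countable part of this order gives, as in Urysohn's lemma,
   a continuous height [c] from [V] to [0, 1] whose fibers over (0, 1) have at
   most two boundary points and are singletons for all but countably many
   heights.  Each fiber, and each of the at most two components of the rest
   [X \ c^-1(0, 1)], is a Peano continuum, hence the image of a path
   (Hahn-Mazurkiewicz); concatenating these paths in the order of the heights
   gives [psi] onto [X], defined on an interval of length barely more than 1, along
   which the height is monotone and 1-Lipschitz.  With [T] the tent map and
   [T \o c] extended by 0, the function [T \o c \o psi] is 2-Lipschitz, so cutting
   the domain of [psi] into three equal parts yields three maps
   [psi_i \o T \o c] which together cover [X] and contract the values of [T \o c]
   by a factor less than 1. *)
Require Import Defs.
From mathcomp Require Import all_boot all_order all_algebra.
From mathcomp Require Import all_classical all_reals.
From mathcomp Require Import topology ereal normedtype.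
From mathcomp Require Import lra.
Set Implicit Arguments.
Unset Strict Implicit.
Unset Printing Implicit Defensive.
Import Order.TTheory GRing.Theory Num.Theory.
Import numFieldTopology.Exports numFieldNormedType.Exports.
Local Open Scope classical_set_scope.
Local Open Scope ring_scope.

(** * Metric spaces and compactness *)

(** Contraction is measured by a single real function: all three maps factor through [T \o c]
    extended by 0, so composites become small once the values of this function do. The tent map is
    there because the rest of [X] may be connected and touch both ends of the height; mapping the
    heights 0 and 1 to the same value lets the function extend over it by a constant. The price is
    the Lipschitz constant 2. If [psi] lives on an interval of length L, then n equal parts contract
    by 2L/n; as L is at least 1, this bound is useless for two parts, while three parts work
    whenever L < 3/2. Here L = 5/4, with factor 5/6. The surplus L - 1 is spent at heights 0 and 1
    and at those whose fiber is not a point: such a fiber has interior, so its height is a value of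
    [c] on a dense sequence, and summable delays suffice. Uncountability enters through the order:
    cut points may follow each other with gaps, but among uncountably many there is always one with
    uncountably many on either side, which makes dyadic bisection possible. *)

Section Metric.
Variables (R : realType) (X : metricType R).
Implicit Types (x y z : X) (A B M O U V W Y : set X).

Lemma nbhs_distP x A :
  nbhs x A <-> exists2 e : R, 0 < e & forall y, mdist x y < e -> A y.
Proof.
split=> [/nbhs_ballP[e e0 xA]|[e e0 xA]].
  by exists e => // y xy; apply: xA; rewrite ballEmdist.
by apply/nbhs_ballP; exists e => // y; rewrite ballEmdist; exact: xA.
Qed.

Lemma open_distP A :
  open A <-> forall x, A x -> exists2 e : R, 0 < e & forall y, mdist x y < e -> A y.
Proof.
split=> [oA x Ax|h].
  by apply/nbhs_distP; exact: open_nbhs_nbhs.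
by rewrite openE => x Ax; apply/nbhs_distP; exact: h.
Qed.

Lemma closed_distP A :
  closed A <-> forall x, (forall e : R, 0 < e -> exists2 y, A y & mdist x y < e) -> A x.
Proof.
split=> [cA x h|h].
  apply: cA => B /nbhs_distP[e e0 xB]; have [y Ay xy] := h e e0.
  by exists y; split => //; exact: xB.
move=> x clx; apply: h => e e0.
have [|y [Ay xy]] := clx [set y | mdist x y < e].
  by apply/nbhs_distP; exists e.
by exists y.
Qed.

Lemma closure_distP A x :
  closure A x <-> forall e : R, 0 < e -> exists2 y, A y & mdist x y < e.
Proof.
split=> [clx e e0|h B /nbhs_distP[e e0 xB]].
  have [|y [Ay xy]] := clx [set y | mdist x y < e].
    by apply/nbhs_distP; exists e.
  by exists y.
by have [y Ay xy] := h e e0; exists y; split => //; exact: xB.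
Qed.

Lemma mdist_ltD x y z (a b : R) : mdist x y < a -> mdist y z < b -> mdist x z < a + b.
Proof. by move=> xa yb; apply: le_lt_trans (metric_triangle x y z) _; rewrite ltrD. Qed.

Lemma mdist_leD x y z (a b : R) :
  mdist x y <= a -> mdist y z <= b -> mdist x z <= a + b.
Proof. by move=> xa yb; apply: le_trans (metric_triangle x y z) _; rewrite lerD. Qed.

Lemma open_ball_lt x (e : R) : open [set y | mdist x y < e].
Proof.
apply/open_distP => y /= xy; exists (e - mdist x y); first by rewrite subr_gt0.
by move=> z yz; have := metric_triangle x y z; lra.
Qed.

Lemma open_ball_gt x (e : R) : open [set y | e < mdist x y].
Proof.
apply/open_distP => y /= xy; exists (mdist x y - e); first by rewrite subr_gt0.
by move=> z yz; have := metric_triangle x z y; rewrite (metric_sym z y); lra.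
Qed.

Lemma separate_points x y : x <> y -> exists2 e : R, 0 < e &
  forall z, mdist x z < e -> mdist y z < e -> False.
Proof.
move=> /eqP xy; exists (mdist x y / 2); first by rewrite divr_gt0 ?mdist_gt0.
move=> z xz yz; have := metric_triangle x z y; rewrite (metric_sym z y); lra.
Qed.

End Metric.

Lemma inv_nat_lt (R : realType) (e : R) : 0 < e -> exists n : nat, n.+1%:R^-1 < e.
Proof.
move=> e0; exists (Num.truncn e^-1); rewrite invf_plt ?posrE//.
exact: truncnS_gt.
Qed.

Section Connected.
Variable T : topologicalType.
Implicit Types (M O : set T).

(** Avoids the relative topology: the open sets need to be disjoint only inside [M], so separations
    can be built from open sets of the ambient space. *)
Lemma connected_openP M : connected M <-> forall O1 O2, open O1 -> open O2 ->
  M `<=` O1 `|` O2 -> M `&` O1 `&` O2 `<=` set0 -> M `<=` O1 \/ M `<=` O2.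
Proof.
split=> [cM O1 O2 oO1 oO2 MO M0|h B B0 [C oC BC] [D cD BD]].
  have [[x [Mx O1x]]|/nonemptyPn M1] := pselect (M `&` O1 !=set0); last first.
    right => x Mx; have [O1x|//] := MO _ Mx.
    by have : set0 x by rewrite -M1.
  left; have E : M `&` O1 = M.
    apply: cM; first by exists x.
      by exists O1.
    exists (~` O2); first exact: open_closedC.
    apply/seteqP; split=> y [My Oy]; split => //.
      by move=> O2y; apply: (M0 y).
    by have [|] := MO _ My.
  by rewrite -E; exact: subIsetr.
have [||MC|MD] := h C (~` D) oC (closed_openC cD).
- move=> x Mx; have [Dx|nDx] := pselect (D x); last by right.
  by left; have : B x; [rewrite BD|rewrite BC => -[]].
- move=> x [[Mx Cx] nDx]; apply: nDx.
  by have : B x; [rewrite BC|rewrite BD => -[]].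
- by rewrite BC; apply/setIidPl.
- case: B0 => x Bx; exfalso.
  have : (M `&` D) x by rewrite -BD.
  by move=> [Mx Dx]; exact: (MD x).
Qed.

End Connected.

Section Compact.
Variables (R : realType).

Lemma compact_seq (T : pseudoMetricType R) (A : set T) (u : nat -> T) :
  compact A -> (forall n, A (u n)) ->
  exists2 x, A x & forall (e : R) N, 0 < e -> exists2 n, (N <= n)%N & ball x e (u n).
Proof.
move=> cA Au.
have [x [Ax clx]] := cA (u @ \oo) _ (ltac:(exists 0%N => //= n _; exact: Au)).
exists x => // e N e0.
have [y [/= [n Nn <-] xy]] : [set u n | n in [set n | (N <= n)%N]] `&` ball x e !=set0.
  apply: clx; first by exists N => //= n Nn; exists n.
  exact: nbhsx_ballx.
by exists n.
Qed.

Variable X : metricType R.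
Hypothesis cX : compact [set: X].

Lemma compact_dist_seq (u : nat -> X) : exists x, forall (e : R) N, 0 < e ->
  exists2 n, (N <= n)%N & mdist x (u n) < e.
Proof.
have [x _ h] := compact_seq cX (fun n => I : setT (u n)).
by exists x => e N e0; have [n Nn] := h e N e0; rewrite ballEmdist; exists n.
Qed.

(** Otherwise a greedy choice yields an infinite [e]-separated sequence, which has no cluster
    point. *)
Lemma finite_net (Y : set X) (e : R) : 0 < e ->
  exists2 s : seq X, (forall z, z \in s -> Y z) &
    forall x, Y x -> exists2 z, z \in s & mdist x z < e.
Proof.
move=> e0; apply: contrapT => /forall2NP h.
have pick (s : seq X) : exists x, (forall z, z \in s -> Y z) ->
    Y x /\ forall z, z \in s -> e <= mdist x z.
  have [sY|nsY] := pselect (forall z, z \in s -> Y z).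
    have [//|/existsNP[x /not_implyP[Yx hx]]] := h s.
    exists x => _; split=> // z zs; rewrite leNgt; apply/negP => xz; apply: hx.
    by exists z.
  have [|/existsNP[x _]] := h [::]; last by exists x => /nsY.
  by move=> []; move=> z; rewrite in_nil.
have [f fP] := choice pick.
pose L := fix L n := if n is n'.+1 then f (L n') :: L n' else [::].
pose u n := f (L n).
have LY n : forall z, z \in L n -> Y z.
  elim: n => [z|n IH z /=]; first by rewrite in_nil.
  by rewrite inE => /orP[/eqP->|/IH//]; have [] := fP _ IH.
have uL m n : (m < n)%N -> u m \in L n.
  elim: n => // n IH; rewrite ltnS leq_eqVlt => /orP[/eqP->|/IH mL] /=.
    by rewrite inE eqxx.
  by rewrite inE mL orbT.
have [x hx] := compact_dist_seq u.
have e20 : 0 < e / 2 by rewrite divr_gt0.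
have [m _ xm] := hx _ 0%N e20; have [n mn xn] := hx _ m.+1 e20.
have [_ /(_ _ (uL _ _ mn))] := fP (L n) (LY n); rewrite -/(u n).
have := metric_triangle (u n) x (u m); rewrite (metric_sym _ x); lra.
Qed.

Lemma dense_seq (x0 : X) : exists D : nat -> X, forall x (e : R), 0 < e ->
  exists n, mdist x (D n) < e.
Proof.
have net n : exists s : seq X, forall x, exists2 z, z \in s & mdist x z < n.+1%:R^-1.
  have [|s _ sP] := @finite_net setT n.+1%:R^-1; first by rewrite invr_gt0.
  by exists s => x; exact: sP.
have [s sP] := choice net.
exists (fun n => if unpickle n is Some (i, j) then nth x0 (s i) j else x0).
move=> x e e0.
have [n ne] := inv_nat_lt e0.
have [z zs xz] := sP n x.
exists (pickle (n, index z (s n))); rewrite pickleK nth_index //.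
exact: lt_trans xz ne.
Qed.

End Compact.

(** * The Hahn-Mazurkiewicz theorem *)

Section Chains.
Variables (T : Type).
Implicit Types (Q : T -> T -> Prop) (S : set T).

(* Chains are padded: they are constant from index [m] on. *)
Definition chain Q S (x y : T) (m : nat) (z : nat -> T) :=
  [/\ z 0%N = x, forall j, (m <= j)%N -> z j = y, forall j, S (z j) &
      forall j, Q (z j) (z j.+1)].

Lemma chain_cat Q S x y w m m' z z' : chain Q S x y m z -> chain Q S y w m' z' ->
  chain Q S x w (m + m') (fun j => if (j < m)%N then z j else z' (j - m)%N).
Proof.
move=> [z0 zm Sz Qz] [z'0 z'm Sz' Qz']; split=> [|j mj|j|j].
- case: m zm {z'm} => [|m] zm //=; by rewrite subnn z'0 -(zm 0%N).
- by rewrite ltnNge (leq_trans (leq_addr _ _) mj) /= z'm // leq_subRL ?(leq_trans (leq_addr _ _) mj).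
- by case: ifP.
- have [jm|mj] := ltnP j.+1 m; first by rewrite (ltnW jm).
  have [jm|mj'] := ltnP j m.
    have E : j.+1 = m by apply/eqP; rewrite eqn_leq jm.
    by rewrite E subnn z'0 -(zm m) // -E.
  by rewrite subSn.
Qed.

Lemma chain_cat_l Q S x y w m m' z z' j : chain Q S x y m z -> chain Q S y w m' z' ->
  (j <= m)%N ->
  (if (j < m)%N then z j else z' (j - m)%N) = z j.
Proof.
move=> [z0 zm Sz Qz] [z'0 z'm Sz' Qz'] jm; case: ltnP => // mj.
have -> : j = m by apply/eqP; rewrite eqn_leq jm.
by rewrite subnn z'0 zm.
Qed.

Lemma chain_cat_r Q S x y w m m' z z' j : chain Q S x y m z -> chain Q S y w m' z' ->
  (if (m + j < m)%N then z (m + j)%N else z' (m + j - m)%N) = z' j.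
Proof. by rewrite ltnNge leq_addr /= addKn. Qed.

Lemma chain1 Q S x y : Q x y -> Q y y -> S x -> S y ->
  chain Q S x y 1 (fun j => if j is 0 then x else y).
Proof. by move=> Qxy Qyy Sx Sy; split => // -[|j]. Qed.

Lemma chain0 Q S x : Q x x -> S x -> chain Q S x x 0 (fun _ => x).
Proof. by []. Qed.

Lemma chainS Q Q' S S' x y m z : (forall u v, S u -> S v -> Q u v -> Q' u v) ->
  S `<=` S' -> chain Q S x y m z -> chain Q' S' x y m z.
Proof.
move=> QQ SS [z0 zm Sz Qz]; split => // j; first exact: SS.
by apply: QQ.
Qed.

End Chains.

Section Path.
Variables (R : realType) (X : metricType R).
Implicit Types (x y p q : X) (M Y : set X).

(** The [e]-neighborhoods of the reachable and of the unreachable points of [M] are open and cannot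
    meet inside [M], since a common point would prolong a chain into the unreachable part. *)
Lemma connected_chain M x y (e : R) : connected M -> 0 < e -> M x -> M y ->
  exists m z, chain (fun u v => mdist u v < e) M x y m z.
Proof.
move=> cM e0 Mx My.
pose reach := [set w | exists m z, chain (fun u v => mdist u v < e) M x w m z].
have rx : reach x by exists 0%N, (fun _ => x); apply: chain0 => //; rewrite mdistxx.
have rstep u v : reach u -> M u -> M v -> mdist u v < e -> reach v.
  move=> [m [z zP]] Mu Mv uv; exists (m + 1)%N; eexists.
  by apply: chain_cat zP _; apply: chain1 => //; rewrite mdistxx.
pose O1 := \bigcup_(w in M `&` reach) [set v | mdist w v < e].
pose O2 := \bigcup_(w in M `\` reach) [set v | mdist w v < e].
have oO (D : set X) : open (\bigcup_(w in D) [set v | mdist w v < e]).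
  by apply: bigcup_open => w _; exact: open_ball_lt.
have [||MO|MO] := (connected_openP M).1 cM O1 O2 (oO _) (oO _).
- move=> w Mw; have [rw|nrw] := pselect (reach w).
    by left; exists w => //=; rewrite mdistxx.
  by right; exists w => //=; rewrite mdistxx.
- move=> w [[Mw [u [Mu ru] uw]] [v [Mv nrv] vw]]; apply: nrv.
  apply: (rstep w) => //; first exact: (rstep u).
  by rewrite metric_sym.
- have [u [Mu ru] uy] := MO _ My; exact: (rstep u).
- have [v [Mv nrv] vx] := MO _ Mx; exfalso; apply: nrv.
  by apply: (rstep x) => //; rewrite metric_sym.
Qed.

(** Used instead of closeness in distance: such a step can be subdivided into arbitrarily fine steps
    that stay in [Y] and within [e] of [x]. *)
Definition near_in Y (e : R) x y := exists M,
  [/\ connected M, M `<=` Y, M x, M y & forall u v, M u -> M v -> mdist u v <= e].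

Definition unif_locally_connected Y := forall e : R, 0 < e ->
  exists2 d : R, 0 < d & forall x y, Y x -> Y y -> mdist x y < d -> near_in Y e x y.

Lemma near_in_refl Y (e : R) x : 0 <= e -> Y x -> near_in Y e x x.
Proof.
move=> e0 Yx; exists [set x]; split=> //; first exact: connected1.
  by move=> y ->.
by move=> u v -> ->; rewrite mdistxx.
Qed.

Lemma near_in_dist Y (e : R) x y : near_in Y e x y -> mdist x y <= e.
Proof. by move=> [M [_ _ Mx My h]]; exact: h. Qed.

Section Refinement.
Variables (Y : set X) (e e' : R).
Hypotheses (lY : unif_locally_connected Y) (e'0 : 0 < e').

Let S x := [set w | Y w /\ mdist x w <= e].

Lemma near_in_chain M x u v : connected M -> M `<=` Y -> M x -> M u -> M v ->
  (forall u v, M u -> M v -> mdist u v <= e) ->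
  exists m z, chain (near_in Y e') (S x) u v m z.
Proof.
move=> cM MY Mx Mu Mv h; have [d d0 dP] := lY e'0.
have [m [z zP]] := connected_chain cM d0 Mu Mv.
exists m, z; apply: chainS zP => [a b Ma Mb|a Ma]; last by split; [exact: MY|exact: h].
by apply: dP; exact: MY.
Qed.

(** For each [w] of the list that is [near_in] [x], a detour from [x] to [w] and back is put in
    front of the chain to [y]; it runs inside a connected set of diameter at most [e], so it does
    not leave [S x]. *)
Lemma near_in_refine x y (s : seq X) : near_in Y e x y ->
  exists m z, chain (near_in Y e') (S x) x y m z /\
    forall w, w \in s -> near_in Y e x w -> exists2 j, (j <= m)%N & z j = w.
Proof.
move=> xy; elim: s => [|w s [m [z [zP zs]]]].
  have [M [cM MY Mx My h]] := xy.
  by have [m [z zP]] := near_in_chain cM MY Mx Mx My h; exists m, z.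
have [[M [cM MY Mx Mw h]]|nxw] := pselect (near_in Y e x w); last first.
  exists m, z; split=> // u; rewrite inE => /orP[/eqP->//|]; exact: zs.
have [m1 [z1 z1P]] := near_in_chain cM MY Mx Mx Mw h.
have [m2 [z2 z2P]] := near_in_chain cM MY Mx Mw Mx h.
have z3P := chain_cat z1P z2P.
have z4P := chain_cat z3P zP.
eexists; eexists; split; first exact: z4P.
move=> u; rewrite inE => /orP[/eqP->{u} _|us xu].
  exists m1; first by rewrite -addnA leq_addr.
  rewrite (chain_cat_l z3P zP) ?leq_addr// (chain_cat_l z1P z2P)//.
  by case: z1P => _ -> .
have [j jm <-] := zs u us xu; exists (m1 + m2 + j)%N; first by rewrite leq_add2l.
by rewrite (chain_cat_r _ z3P zP).
Qed.

End Refinement.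

Section Peano.
Hypothesis cX : compact [set: X].
Variables (Y : set X) (p q : X).
Hypotheses (clY : closed Y) (cY : connected Y) (lY : unif_locally_connected Y).
Hypotheses (Yp : Y p) (Yq : Y q).

(* [s] is a discrete approximation, with [N] steps of size [e], of a path in
   [Y] from [p] to [q] through every point of [Y]. *)
Definition stage (e : R) (N : nat) (s : nat -> X) :=
  [/\ (0 < N)%N, chain (near_in Y e) Y p q N s &
    forall x, Y x -> exists2 i, (i < N)%N & near_in Y e (s i) x].

(** Each step is replaced by a finer chain that also visits the nearby points of a finite net. All
    chains are padded to a common length, so fine and coarse indices differ by a Euclidean division
    and the approximations share one time scale. *)
Lemma stage_refine (e e' : R) N s : 0 < e' -> stage e N s ->
  exists ms : nat * (nat -> X), [/\ (0 < ms.1)%N, stage e' (N * ms.1) ms.2 &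
   forall i j, (j < ms.1)%N -> mdist (s i) (ms.2 (i * ms.1 + j)%N) <= e].
Proof.
move=> e'0 [N0 [s0 sN sY sP] sd].
have [d d0 dP] := lY e'0.
have [Z ZY Zd] := finite_net cX Y d0.
have e0 : 0 <= e by apply: le_trans (near_in_dist (sP 0%N)); exact: mdist_ge0.
have ref i := near_in_refine lY e'0 Z (sP i).
have [m' ref'] := choice ref; have [z zP] := choice ref' => {ref ref'}.
(* The successor makes every chain reach its end at an index below [m], so the step into the next
   block is trivial up to [near_in_refl]. *)
pose m := (\max_(i < N) m' i).+1.
have m'm i : (i < N)%N -> (m' i < m)%N.
  by move=> iN; rewrite ltnS (@leq_bigmax _ _ (Ordinal iN)).
pose s' k := if (k %/ m < N)%N then z (k %/ m)%N (k %% m)%N else q.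
have s'E i j : (j < m)%N -> s' (i * m + j)%N = if (i < N)%N then z i j else q.
  by move=> jm; rewrite /s' divnMDl// modnMDl divn_small// modn_small// addn0.
have s'm i : s' (i.+1 * m)%N = s i.+1.
  rewrite -[(i.+1 * m)%N]addn0 s'E//; case: ltnP => [iN|/sN//].
  by have [[-> _ _ _] _] := zP i.+1.
have zS i j : Y (z i j) /\ mdist (s i) (z i j) <= e by have [[_ _ zS _] _] := zP i; exact: zS.
exists (m, s'); split=> //=; last first.
  move=> i j jm; rewrite s'E//; case: ltnP => [_|/sN->]; first by have [] := zS i j.
  by rewrite mdistxx.
split; first by rewrite muln_gt0 N0.
  split.
  - have := s'E 0%N 0%N isT; rewrite mul0n addn0 N0 => ->.
    by have [[-> _ _ _] _] := zP 0%N.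
  - by move=> j; rewrite -leq_divRL// => mj; rewrite /s' ltnNge mj.
  - by move=> j; rewrite /s'; case: ifP => // _; have [] := zS (j %/ m)%N (j %% m)%N.
  - move=> k; have kd := divn_eq k m; set i := (k %/ m)%N in kd; set j := (k %% m)%N in kd.
    have jm : (j < m)%N by rewrite ltn_mod.
    have [j1m|mj1] := ltnP j.+1 m.
      rewrite kd -addnS !s'E//; case: ifP => _; last exact/near_in_refl/Yq/ltW.
      by have [[_ _ _ zQ] _] := zP i; exact: zQ.
    have E : j.+1 = m by apply/eqP; rewrite eqn_leq jm.
    have -> : k.+1 = (i.+1 * m)%N by rewrite kd -addnS E mulSn addnC.
    rewrite s'm kd s'E//; case: ltnP => [iN|/leqW/sN->]; last exact/near_in_refl/Yq/ltW.
    have [[_ zE _ zQ] _] := zP i.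
    by rewrite -(zE j.+1)// -ltnS E ltnS ltnW// m'm.
move=> x Yx; have [w wZ xw] := Zd x Yx.
have [i iN siw] := sd w (ZY w wZ).
have [_ /(_ w wZ siw)[j jm zw]] := zP i.
have jm' : (j < m)%N by apply: leq_ltn_trans jm _; exact: m'm.
exists (i * m + j)%N.
  apply: leq_trans (_ : i.+1 * m <= _)%N; first by rewrite mulSn addnC ltn_add2r.
  by rewrite leq_mul2r iN orbT.
rewrite s'E// iN zw; apply: dP => //; first exact: ZY.
by rewrite metric_sym.
Qed.

Lemma dist_bounded : exists2 D : R, 0 < D & forall x y, mdist x y <= D.
Proof.
have [s _ sP] := finite_net cX setT (@ltr01 R).
pose K := \sum_(z <- s) mdist p z.
have K0 : 0 <= K by apply: sumr_ge0 => z _; exact: mdist_ge0.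
have pK x : mdist p x <= K + 1.
  have [z zs xz] := sP x I; apply: (mdist_leD (y := z)); last by rewrite metric_sym ltW.
  rewrite /K (big_rem z)//= lerDl; apply: sumr_ge0 => w _; exact: mdist_ge0.
exists (K + 1 + (K + 1)); first by lra.
by move=> x y; apply: (mdist_leD (y := p)) => //; rewrite metric_sym.
Qed.

End Peano.
End Path.

Section PeanoPath.
Variables (R : realType) (X : metricType R).
Hypothesis cX : compact [set: X].
Variables (Y : set X) (p q : X).
Hypotheses (clY : closed Y) (cY : connected Y) (lY : unif_locally_connected Y).
Hypotheses (Yp : Y p) (Yq : Y q).

Lemma half_pow_lt (D e : R) : 0 < D -> 0 < e -> exists n, D * 2^-1 ^+ n < e.
Proof.
move=> D0 e0; exists (Num.truncn (D / e)).
rewrite exprVn ltr_pdivrMr ?exprn_gt0// mulrC -ltr_pdivrMr//.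
apply: lt_le_trans (truncnS_gt _) _.
by rewrite -natrX ler_nat ltn_expl.
Qed.

Lemma truncn_mul_div (t : R) (N m : nat) : (0 < m)%N ->
  (Num.truncn (t * (N * m)%:R) %/ m)%N = Num.truncn (t * N%:R).
Proof.
move=> m0; have m0' : (0 : R) < m%:R by rewrite ltr0n.
have [t0|t0] := leP 0 (t * N%:R); last first.
  rewrite (truncn_floor (t * N%:R)) leNgt t0/=.
  by rewrite truncn_floor leNgt natrM mulrA pmulr_llt0// t0/= div0n.
apply/esym/truncn_def; rewrite natrM mulrA.
have /andP[h1 h2] := truncn_itv (mulr_ge0 t0 (ltW m0')).
set K := Num.truncn _ in h1 h2 *.
rewrite -(ler_pM2r m0') -(ltr_pM2r m0') -!natrM; apply/andP; split.
  by apply: le_trans h1; rewrite ler_nat leq_divM.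
by apply: lt_le_trans h2 _; rewrite ler_nat ltn_ceil.
Qed.

Lemma truncn_close (s t : R) : `|s - t| < 1 ->
  (Num.truncn s <= (Num.truncn t).+1)%N.
Proof.
move=> st; rewrite truncn_le_nat -[in X in _ < X]natr1.
by have := truncnS_gt t; move: st; rewrite ltr_norml => /andP[? ?]; lra.
Qed.

(** The step functions [f n] given by successive stages move by at most [eps n] from one to the
    next, so [g] is their uniform limit. As [Num.truncn] is 0 on negative numbers and stages are
    padded with [q], the limit is constant outside [0, 1]. *)
Theorem peano_path : exists g : R -> X,
  [/\ forall e : R, 0 < e -> exists2 d : R, 0 < d &
        forall s t, `|s - t| < d -> mdist (g s) (g t) < e,
      forall t, t <= 0 -> g t = p, forall t, 1 <= t -> g t = q,
      forall t, Y (g t) & forall x, Y x -> exists t, g t = x].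
Proof.
have [D D0 Dd] := dist_bounded cX p.
pose eps n := D * 2^-1 ^+ n.
have eps0 n : 0 < eps n by rewrite mulr_gt0 ?exprn_gt0 ?invr_gt0.
have epsS n : eps n = eps n.+1 + eps n.+1 by rewrite /eps exprS; lra.
have st0 : stage Y p q (eps 0%N) 1 (fun i => if i is 0%N then p else q).
  have YY x y : Y x -> Y y -> near_in Y (eps 0%N) x y.
    by move=> Yx Yy; exists Y; split=> // u v _ _; rewrite /eps expr0 mulr1.
  split=> //; last by move=> x Yx; exists 0%N => //; exact: YY.
  by apply: chain1 => //; exact: YY.
have /choice[F FP] (a : nat * (nat * (nat -> X))) : exists b : nat * (nat -> X),
    stage Y p q (eps a.1) a.2.1 a.2.2 ->
    [/\ (0 < b.1)%N, stage Y p q (eps a.1.+1) (a.2.1 * b.1) b.2 &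
      forall i j, (j < b.1)%N -> mdist (a.2.2 i) (b.2 (i * b.1 + j)%N) <= eps a.1].
  have [sa|nsa] := pselect (stage Y p q (eps a.1) a.2.1 a.2.2); last by exists (0%N, fun _ => p).
  by have [b bP] := stage_refine cX lY Yq (eps0 a.1.+1) sa; exists b.
pose st := fix st n := if n is n'.+1 then
  let b := F (n', st n') in ((st n').1 * b.1, b.2)%N else (1%N, fun i => if i is 0%N then p else q).
pose N n := (st n).1; pose s n := (st n).2.
have stP n : stage Y p q (eps n) (N n) (s n).
  elim: n => // n IH.
  by have [] := FP (n, st n) IH.
pose m n := (F (n, st n)).1.
have m0 n : (0 < m n)%N by have [] := FP (n, st n) (stP n).
have NS n : N n.+1 = (N n * m n)%N by [].
have sS n i j : (j < m n)%N -> mdist (s n i) (s n.+1 (i * m n + j)%N) <= eps n.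
  by have [_ _ h] := FP (n, st n) (stP n); exact: h.
have N0 n : (0 < N n)%N by have [] := stP n.
pose f n (t : R) := s n (Num.truncn (t * (N n)%:R)).
have fS n t : mdist (f n t) (f n.+1 t) <= eps n.
  rewrite /f -(@truncn_mul_div t (N n) (m n))// -NS.
  by rewrite [in X in mdist _ X](divn_eq (Num.truncn (t * (N n.+1)%:R)) (m n)) sS// ltn_mod.
have fD n k t : mdist (f n t) (f (n + k)%N t) <= eps n + eps n - (eps (n + k)%N + eps (n + k)%N).
  elim: k => [|k IH]; first by rewrite addn0 mdistxx subrr.
  rewrite addnS; apply: le_trans (metric_triangle _ (f (n + k)%N t) _) _.
  by have := fS (n + k)%N t; have := epsS (n + k)%N; lra.
have /choice[g gP] t := compact_dist_seq cX (fun n => f n t).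
have fg n t : mdist (f n t) (g t) <= eps n + eps n.
  apply/ler_addgt0Pr => e e0; have [k nk /= gk] := gP t e n e0.
  apply: le_trans (metric_triangle _ (f k t) _) _.
  rewrite (metric_sym _ (g t)); have := fD n (k - n)%N t; rewrite subnKC//.
  by have := eps0 k; lra.
have sY n i : Y (s n i) by have [_ [_ _ h _] _] := stP n; exact: h.
have snear n i : mdist (s n i) (s n i.+1) <= eps n.
  by have [_ [_ _ _ h] _] := stP n; exact: near_in_dist (h i).
have gY t : Y (g t).
  apply: (closed_distP Y).1 clY _ _ => e e0; have [n _ gn] := gP t e 0%N e0.
  by exists (f n t) => //; exact: sY.
(* The 5 below: twice [eps n] from each of [g u], [g v] to [f n], plus [eps n] for one step of the
   stage, since [u] and [v] closer than 1 / [N n] have indices differing by at most one. *)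
have gU e : 0 < e -> exists2 d : R, 0 < d &
        forall s t, `|s - t| < d -> mdist (g s) (g t) < e.
  move=> e0; have [n ne] := half_pow_lt D0 (divr_gt0 e0 (ltr0n R 5)).
  rewrite -/(eps n) in ne.
  have Nn0 : (0 : R) < (N n)%:R by rewrite ltr0n.
  exists (N n)%:R^-1; first by rewrite invr_gt0.
  have step a b : (a <= b.+1)%N -> (b <= a)%N -> mdist (s n a) (s n b) <= eps n.
    rewrite leq_eqVlt => /orP[/eqP-> _|]; first by rewrite metric_sym.
    by rewrite ltnS => ab ba; have/eqP-> : a == b by [rewrite eqn_leq ab]; rewrite mdistxx ltW.
  move=> u v uv.
  have uv' : `|u * (N n)%:R - v * (N n)%:R| < 1.
    by rewrite -mulrBl normrM (gtr0_norm Nn0) -ltr_pdivlMr// mul1r.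
  have ffn : mdist (f n u) (f n v) <= eps n.
    have [h|/ltnW h] := leqP (Num.truncn (v * (N n)%:R)) (Num.truncn (u * (N n)%:R)).
      by apply: step => //; exact: truncn_close.
    by rewrite metric_sym; apply: step => //; apply: truncn_close; rewrite distrC.
  have := metric_triangle (g u) (f n u) (g v); have := metric_triangle (f n u) (f n v) (g v).
  rewrite (metric_sym (g u) (f n u)); have := fg n u; have := fg n v; lra.
have lim0 x y : (forall n, mdist x y <= eps n + eps n) -> x = y.
  move=> h; apply/eqP; rewrite -[_ == _]negbK -mdist_gt0; apply/negP => xy.
  have [n ne] := half_pow_lt D0 (divr_gt0 xy (ltr0n R 2)).
  by have := h n; rewrite -/(eps n) in ne; lra.
exists g; split=> //.
- move=> t t0; apply/esym/lim0 => n; have := fg n t; rewrite /f.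
  have -> : Num.truncn (t * (N n)%:R) = 0%N.
    apply/eqP; rewrite -leqn0 truncn_le_nat; apply: le_lt_trans ltr01.
    by rewrite mulr_le0_ge0.
  by have [_ [-> _ _ _] _] := stP n.
- move=> t t0; apply/esym/lim0 => n; have := fg n t; rewrite /f.
  have h : (N n <= Num.truncn (t * (N n)%:R))%N.
    by rewrite truncn_ge_nat ?ler_peMl// mulr_ge0// (le_trans ler01).
  by have [_ [_ -> // _ _] _] := stP n.
(* The times at which [f n] comes [eps n]-close to [x] cluster at some [a] in [0, 1], and uniform
   continuity gives [g a = x]. *)
- move=> x Yx.
  have /choice[i iP] n : exists i, (i < N n)%N /\ mdist (s n i) x <= eps n.
    have [_ _ /(_ x Yx)[i iN six]] := stP n; exists i; split=> //.
    exact: near_in_dist six.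
  pose t n : R := (i n)%:R / (N n)%:R.
  have Nn0 n : (0 : R) < (N n)%:R by rewrite ltr0n.
  have ft n : f n (t n) = s n (i n).
    by rewrite /f /t divfK ?gt_eqF// natrK.
  have t01 n : `[0, 1]%classic (t n).
    rewrite /= in_itv/= /t divr_ge0// ler_pdivrMr// mul1r ler_nat.
    by have [/ltnW] := iP n.
  have [a _ aP] := compact_seq (@segment_compact R 0 1) t01.
  exists a; apply/eqP; rewrite -[_ == _]negbK -mdist_gt0; apply/negP => xy.
  have [n0 ne] := half_pow_lt D0 (divr_gt0 xy (ltr0n R 6)); rewrite -/(eps n0) in ne.
  have [d d0 dP] := gU _ (divr_gt0 xy (ltr0n R 2)).
  have [n nn0 /dP] := aP d n0 d0.
  have epsn : eps n <= eps n0.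
    by rewrite ler_pM2l// ler_wiXn2l ?invr_ge0// invf_le1// ler1n.
  have := metric_triangle (g a) (g (t n)) x; have := metric_triangle (g (t n)) (f n (t n)) x.
  have := fg n (t n); have [_] := iP n; rewrite ft (metric_sym (s n (i n)) (g _)); lra.
Qed.

End PeanoPath.

(** * Concatenation of countably many paths *)

Section JumpTime.
Variables (R : realType) (td : nat -> R) (eps : R).
Hypothesis eps0 : 0 < eps.

Let J n (t : R) := \sum_(k < n) (2^-1 ^+ k.+1 * (td k < t)%R%:R) : R.

(* [h] is strictly increasing and jumps at every [td n]. *)
Lemma jump_time : exists h : R -> R,
  [/\ forall t, t <= h t <= t + eps,
      forall t d, 0 <= d -> h t + d <= h (t + d) &
      forall n, exists2 w, 0 < w & forall t, td n < t -> h (td n) + w <= h t].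
Proof.
have p0 k : 0 < (2^-1 : R) ^+ k.+1 by rewrite exprn_gt0// invr_gt0.
have J0 n t : 0 <= J n t by apply: sumr_ge0 => k _; rewrite mulr_ge0// ltW.
have J1 n t : J n t <= 1.
  apply: (@le_trans _ _ (1 - 2^-1 ^+ n)); last by rewrite gerBl exprn_ge0// invr_ge0.
  elim: n => [|n IH]; first by rewrite /J big_ord0 expr0 subrr.
  rewrite /J big_ord_recr/= -/(J n t) exprS.
  have : 0 <= (2^-1 : R) ^+ n by rewrite exprn_ge0// invr_ge0.
  by case: (td n < t); rewrite /= ?mulr1 ?mulr0; lra.
have JM n t t' : t <= t' -> J n t <= J n t'.
  move=> tt'; apply: ler_sum => k _; rewrite ler_pM2l// ler_nat.
  by case: ltP => // /lt_le_trans /(_ tt') ->.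
have JN n m t : (n <= m)%N -> J n t <= J m t.
  move=> nm; rewrite -(subnKC nm); elim: (m - n)%N => [|k IH]; first by rewrite addn0.
  by rewrite addnS {2}/J big_ord_recr/=; apply: le_trans IH _; rewrite lerDl mulr_ge0// ltW.
have Jj n t m : td n < t -> (n < m)%N -> J m (td n) + 2^-1 ^+ n.+1 <= J m t.
  move=> nt nm; rewrite /J (bigD1 (Ordinal nm))//= [leRHS](bigD1 (Ordinal nm))//=.
  rewrite ltxx mulr0 add0r nt mulr1 [leLHS]addrC lerD2l.
  apply: ler_sum => k _; rewrite ler_pM2l// ler_nat.
  by case: ltP => // /lt_trans /(_ nt) ->.
(* The total weight of the [td k] strictly before [t]; it is at most 1, so [eps * S] delays by at
   most [eps]. Strictness puts the jump immediately after [td n]. *)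
pose S t := sup (range (J ^~ t)).
have hS t : has_sup (range (J ^~ t)).
  by split; [exists (J 0%N t), 0%N|exists 1 => _ [n _ <-]].
have JS n t : J n t <= S t by apply: ub_le_sup; [case: (hS t)|exists n].
have SP t x : (forall n, J n t <= x) -> S t <= x.
  by move=> h; apply: ge_sup; [case: (hS t)|move=> _ [n _ <-]].
have S0 t : 0 <= S t by apply: le_trans (J0 0%N t) (JS _ _).
have S1 t : S t <= 1 by apply: SP.
have SM t t' : t <= t' -> S t <= S t'.
  by move=> tt'; apply: SP => n; apply: le_trans (JM n _ _ tt') (JS _ _).
exists (fun t => t + eps * S t); split=> [t|t d d0|n].
- by rewrite lerDl mulr_ge0 ?(ltW eps0)// lerD2l ler_piMr// ltW.
- by rewrite addrAC lerD2l ler_pM2l// SM// lerDl.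
- exists (eps * 2^-1 ^+ n.+1); first by rewrite mulr_gt0.
  move=> t nt; rewrite -addrA -mulrDr lerD ?(ltW nt)// ler_pM2l//.
  rewrite -lerBrDr; apply: SP => m; rewrite lerBrDr.
  apply: le_trans (JS (maxn m n.+1) t); apply: le_trans (Jj _ _ _ nt (leq_maxr m n.+1)).
  by rewrite lerD2r JN// leq_maxl.
Qed.

End JumpTime.

Section ConcatPaths.
Variables (R : realType) (X : metricType R).
Variables (g : R -> R -> X) (td : nat -> R) (eps : R).
Hypothesis eps0 : 0 < eps.
Hypothesis gC : forall t u (e : R), 0 < e -> exists2 d : R, 0 < d &
  forall u', `|u - u'| < d -> mdist (g t u) (g t u') < e.
Hypothesis g_le0 : forall t u, u <= 0 -> g t u = g t 0.
Hypothesis g_ge1 : forall t u, 1 <= u -> g t u = g t 1.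
Hypothesis g_const : forall t, (forall n, td n <> t) -> forall u, g t u = g t 0.
Hypothesis g_left : forall t (e : R), 0 < e -> exists2 d : R, 0 < d &
  forall t' u, t - d < t' -> t' < t -> mdist (g t 0) (g t' u) < e.
Hypothesis g_right : forall t (e : R), 0 < e -> exists2 d : R, 0 < d &
  forall t' u, t < t' -> t' < t + d -> mdist (g t 1) (g t' u) < e.

(* [v] is the generalized inverse of the function [h] of [jump_time]: it stays
   at [td n] for as long as [h] jumps there, which leaves the time to run
   through the path [g (td n)]. *)
Lemma concat_paths : exists (psi : R -> X) (v : R -> R),
  [/\ forall s (e : R), 0 < e -> exists2 d : R, 0 < d &
        forall s', `|s - s'| < d -> mdist (psi s) (psi s') < e,
      forall s s', `|v s - v s'| <= `|s - s'|,
      forall s, exists u, psi s = g (v s) u &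
      forall t u : R, exists2 s : R, t <= s <= t + eps & psi s = g t u].
Proof.
have [h [h_id h_exp h_jump]] := jump_time td eps0.
have hlt t t' : t < t' -> h t < h t'.
  by move=> tt'; have := h_exp t (t' - t); rewrite subr_ge0 [t + _]addrC subrK => /(_ (ltW tt')); lra.
(* [W t] is a time slot available at [t]. It can vanish only at times outside [td], where the path
   [g t] is constant and the division by [W t] in [psi] does no harm. *)
have /choice[W WP] t : exists w, [/\ 0 <= w, forall t', t < t' -> h t + w <= h t' &
    0 < w \/ forall n, td n <> t].
  have [[n <-]|/forallNP nD] := pselect (exists n, td n = t).
    by have [w w0 wP] := h_jump n; exists w; split; [exact: ltW|exact: wP|left].
  exists 0; split=> //; last by right.
  by move=> t' /hlt/ltW; rewrite addr0.
pose S s := [set t | h t <= s].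
have hS s : has_sup (S s).
  split; first by exists (s - eps); rewrite /S/=; have := h_id (s - eps); lra.
  by exists s => t; rewrite /S/=; have := h_id t; lra.
pose v s := sup (S s).
have v_ge s t : h t <= s -> t <= v s by move=> hts; apply: ub_le_sup; [case: (hS s)|].
have v_gt s t : t < v s -> exists2 t', t < t' & h t' <= s.
  by move=> tv; have [t' St' tt'] := sup_gt (hS s).1 tv; exists t'.
have v_lip s s' : s <= s' -> v s <= v s' <= v s + (s' - s).
  move=> ss'; apply/andP; split.
    by apply: ge_sup; [case: (hS s)|move=> t hts; apply: v_ge; exact: le_trans ss'].
  rewrite leNgt; apply/negP => /v_gt[t tt' hts].
  have := h_exp (t - (s' - s)) (s' - s); rewrite subr_ge0 subrK => /(_ ss') hh.
  have := @v_ge s (t - (s' - s)); lra.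
pose psi s := g (v s) ((s - h (v s)) / W (v s)).
exists psi, v; split.
(* Near [s], either [v s'] is still [t] and continuity of the path [g t] applies, or it has left
   [t]. In the latter case [d4] and [d5] force [s] to the matching end of the slot, where [psi s] is
   [g t 0] or [g t 1], and [g_left] or [g_right] takes over. *)
- move=> s e e0; set t := v s; have [W0 Wh WD] := WP t.
  have [d1 d10 d1P] := g_left t e0; have [d2 d20 d2P] := g_right t e0.
  have [d3 d30 d3P] : exists2 d : R, 0 < d & forall s', `|s - s'| < d ->
      mdist (g t ((s - h t) / W t)) (g t ((s' - h t) / W t)) < e.
    case: WD => [Wgt0|/g_const gc]; last first.
      by exists 1 => // s' _; rewrite gc (gc (_ / _)) mdistxx.
    have [d d0 dP] := gC t ((s - h t) / W t) e0; exists (d * W t); first exact: mulr_gt0.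
    move=> s' ss'; apply: dP; rewrite -mulrBl opprB addrA subrK normrM.
    by rewrite [`|(W t)^-1|]gtr0_norm ?invr_gt0// ltr_pdivrMr.
  have [d4 d40 d4P] : exists2 d : R, 0 < d & h t < s -> d <= s - h t.
    case: (ltP (h t) s) => [hs|_]; last by exists 1.
    by exists (s - h t) => //; rewrite subr_gt0.
  have [d5 d50 d5P] : exists2 d : R, 0 < d & s < h t + W t -> d <= h t + W t - s.
    case: (ltP s (h t + W t)) => [hs|_]; last by exists 1.
    by exists (h t + W t - s) => //; rewrite subr_gt0.
  exists (Num.min d1 (Num.min d2 (Num.min d3 (Num.min d4 d5)))); first by rewrite !lt_min d10 d20 d30 d40.
  move=> s'; rewrite !lt_min => /and5P[l1 l2 l3 l4 l5].
  have vv : `|t - v s'| <= `|s - s'|.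
    case: (leP s s') => [ss'|/ltW ss'].
      have /andP[? ?] := v_lip _ _ ss'.
      by rewrite distrC [`|s - _|]distrC !ger0_norm ?subr_ge0// lerBlDl.
    have /andP[? ?] := v_lip _ _ ss'.
    by rewrite !ger0_norm ?subr_ge0// lerBlDl.
  rewrite /psi -/t; have [tv|tv|tv] := ltgtP t (v s'); last first.
  + by rewrite -tv; exact: d3P.
  + have s'h : s' < h t by rewrite ltNge; apply/negP => /v_ge; rewrite leNgt tv.
    have sh : s <= h t.
      rewrite leNgt; apply/negP => hs; have := d4P hs.
      by move: l4; rewrite ltr_norml; lra.
    rewrite g_le0; last by rewrite mulr_le0_ge0 ?invr_ge0// subr_le0.
    by apply: d1P => //; move: vv l1; rewrite ger0_norm ?subr_ge0 ?(ltW tv)//; lra.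
  + have [t' tt' ht's'] := v_gt _ _ tv.
    have s'h : h t + W t <= s' := le_trans (Wh _ tt') ht's'.
    have sh : h t + W t <= s.
      rewrite leNgt; apply/negP => hs; have := d5P hs.
      by move: l5; rewrite ltr_norml; lra.
    have -> : g t ((s - h t) / W t) = g t 1.
      case: WD => [Wgt0|/g_const gc]; last by rewrite gc (gc 1).
      by apply: g_ge1; rewrite ler_pdivlMr// mul1r; lra.
    by apply: d2P => //; move: vv l2; rewrite ler0_norm ?subr_le0 ?(ltW tv)//; lra.
- move=> s s'; case: (leP s s') => [ss'|/ltW ss'].
    have /andP[? ?] := v_lip _ _ ss'.
    by rewrite distrC [`|s - _|]distrC !ger0_norm ?subr_ge0// lerBlDl.
  have /andP[? ?] := v_lip _ _ ss'.
  by rewrite !ger0_norm ?subr_ge0// lerBlDl.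
- by move=> s; exists ((s - h (v s)) / W (v s)).
- move=> t u; have [W0 Wh WD] := WP t.
  pose u' := Num.max 0 (Num.min u 1).
  have u'0 : 0 <= u' by rewrite /u' le_max lexx.
  have u'1 : u' <= 1 by rewrite /u' ge_max ler01 ge_min lexx orbT.
  have gu' : g t u' = g t u.
    rewrite /u' /Num.max /Num.min; case: (ltP u 1) => [_|/g_ge1->]; last by rewrite ltr01.
    by case: (ltP 0 u) => // /g_le0 ->.
  have uW : 0 <= u' * W t <= W t by rewrite mulr_ge0//= ler_piMl.
  have vs : v (h t + u' * W t) = t.
    apply/eqP; rewrite eq_le v_ge ?lerDl; last by case/andP: uW.
    rewrite andbT leNgt; apply/negP => /v_gt[t' tt' ht'].
    have := Wh ((t + t') / 2); have := hlt ((t + t') / 2) t'; lra.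
  exists (h t + u' * W t).
    apply/andP; split; first by have := h_id t; lra.
    apply/ler_addgt0Pr => e e0; have := Wh (t + e); have := h_id (t + e); lra.
  rewrite /psi vs addrAC subrr add0r.
  case: WD => [Wgt0|/g_const gc]; last by rewrite gc (gc u).
  by rewrite mulfK ?gt_eqF.
Qed.

End ConcatPaths.

(** * Uncountably many local cut points *)

Section Countability.
Variable T : Type.
Implicit Types A B : set T.

Lemma countable_subset A B : A `<=` B -> countable B -> countable A.
Proof. by move=> AB; apply: sub_countable; exact: subset_card_le. Qed.

Lemma countable_union A B : countable A -> countable B -> countable (A `|` B).
Proof.
move=> cA cB; rewrite -bigcup2E; apply: bigcup_countable; first exact: countableP.
by move=> [|[|n]] _ //=; exact: countable0.
Qed.

Lemma countable_cover (I : countType) (F : I -> set T) A :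
  A `<=` \bigcup_i F i -> ~ countable A -> exists i, ~ countable (A `&` F i).
Proof.
move=> AF; apply: contra_notP => /forallNP h.
apply: (@countable_subset _ (\bigcup_i (A `&` F i))).
  by move=> x Ax; have [i _ Fx] := AF _ Ax; exists i.
by apply: bigcup_countable => [|i _]; [exact: countableP|exact: contrapT (h i)].
Qed.

End Countability.

Section LocalCuts.
Variables (R : realType) (X : metricType R).
Implicit Types (x y a b : X) (A B V : set X).

(* The point [x] separates [a] from [b] in [V]. *)
Definition cuts V a b x A B :=
  [/\ V x, open A /\ open B, A `&` B `<=` set0, A `|` B = V `\ x & A a /\ B b].

Lemma cuts_sym V a b x A B : cuts V a b x A B -> cuts V b a x B A.
Proof. by move=> [Vx [oA oB] AB0 AB [Aa Bb]]; split; rewrite // 1?setIC 1?setUC. Qed.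

Hypothesis lcX : locally_connected X.

Lemma component_open V x : open V -> open (connected_component V x).
Proof.
move=> oV; apply/open_distP => y Cy.
have [U [oU Uy cU UV]] := lcX (open_nbhs_nbhs (conj oV (@connected_component_sub _ _ _ _ Cy))).
have [e e0 he] := (open_distP U).1 oU y Uy.
exists e => // z /he Uz; apply: connected_component_trans Cy _.
by exists U.
Qed.

Hypothesis cX : compact [set: X].

(** A separation of [U] without [x] restricts to [V] unless one side misses [V]. That side, with [x]
    removed, would be separated in [U] from the other side together with [V], against connectedness
    of [U]. *)
Lemma local_cut_cuts x (U V : set X) : nbhs x U -> connected U ->
    ~ connected (U `\ x) -> open V -> V x -> V `<=` U ->
  exists A B, [/\ open A /\ open B, A `&` B `<=` set0, A `|` B = V `\ x, A !=set0 & B !=set0].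
Proof.
move=> xU cU ncU oV Vx VU.
have nx : open (~` [set x]).
  apply: closed_openC; apply/closed_distP => y h; apply/eqP; rewrite -[_ == _]negbK -mdist_gt0.
  by apply/negP => /h[z ->]; rewrite ltxx.
have [O1 [O2 [oO1 oO2 UO UO0 [n1 n2]]]] : exists O1 O2, [/\ open O1, open O2,
    U `\ x `<=` O1 `|` O2, (U `\ x) `&` O1 `&` O2 `<=` set0 &
    ~ (U `\ x `<=` O1) /\ ~ (U `\ x `<=` O2)].
  apply: contrapT => h; apply: ncU; apply/connected_openP => O1 O2 oO1 oO2 UO UO0.
  apply: contrapT => /not_orP[n1 n2]; apply: h.
  by exists O1, O2.
have half P1 P2 : open P1 -> open P2 -> U `\ x `<=` P1 `|` P2 ->
    (U `\ x) `&` P1 `&` P2 `<=` set0 -> ~ (U `\ x `<=` P2) ->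
    V `&` P1 `&` ~` [set x] !=set0.
  move=> oP1 oP2 UP UP0 nP; apply: contrapT => /nonemptyPn V0.
  have V0' z : V z -> P1 z -> z <> x -> False.
    by move=> Vz Pz zx; have : set0 z by rewrite -V0.
  have [||||UP1|UP2] := (connected_openP U).1 cU (P1 `&` ~` [set x]) (P2 `|` V).
  - exact: openI.
  - exact: openU.
  - move=> z Uz; have [->|zx] := pselect (z = x); first by right; right.
    by have [|] := UP z (conj Uz zx); [left|right; left].
  - move=> z [[Uz [Pz zx]] [P2z|Vz]]; last exact: (V0' z).
    by apply: (UP0 z).
  - by have [_ /=] := UP1 x (nbhs_singleton xU).
  - apply: nP => z [Uz zx]; have [//|Vz] := UP2 z Uz.
    by have [Pz|//] := UP z (conj Uz zx); have := V0' z Vz Pz zx.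
exists (V `&` O1 `&` ~` [set x]), (V `&` O2 `&` ~` [set x]); split.
- by split; apply: openI => //; exact: openI.
- by move=> z [[[Vz O1z] zx] [[_ O2z] _]]; apply: (UO0 z); split=> //; split=> //; split => //; exact: VU.
- apply/seteqP; split=> z; first by move=> [] [[Vz _] zx].
  move=> [Vz zx]; have [Oz|Oz] := UO z (conj (VU _ Vz) zx); [left|right]; by [].
- exact: half oO1 oO2 UO UO0 n2.
- apply: half oO2 oO1 _ _ n1; first by rewrite setUC.
  by rewrite -setIA [X in _ `&` X]setIC setIA.
Qed.

(** Pigeonhole over countably many data: center, [a] and [b] from a dense sequence, radius 1/(n+1).
    The margin [r / 4] keeps the cut points away from the sphere of radius [r / 2] used in
    [cut_piece]. *)
Lemma uncountable_cuts : ~ countable [set x : X | local_cut_point x] ->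
  exists (y : X) (r : R) (a b : X) (E : set X),
    [/\ 0 < r, ~ countable E, forall x, E x -> mdist y x <= r / 4 &
     forall x, E x -> exists A B,
       cuts (connected_component [set z | mdist y z < r] y) a b x A B].
Proof.
move=> hcut.
have [x0 _] : [set x : X | local_cut_point x] !=set0.
  by apply: contrapT => /nonemptyPn h; apply: hcut; rewrite h; exact: countable0.
have [D DP] := dense_seq cX x0.
have Dopen O x : open O -> O x -> exists n, O (D n).
  by move=> oO Ox; have [e e0 h] := (open_distP O).1 oO x Ox; have [n /h] := DP x e e0; exists n.
pose r n : R := n.+1%:R^-1.
pose V i n := connected_component [set z | mdist (D i) z < r n] (D i).
pose F (i : nat * nat * (nat * nat)) := [set x | mdist (D i.1.1) x <= r i.1.2 / 4 /\
  exists A B, cuts (V i.1.1 i.1.2) (D i.2.1) (D i.2.2) x A B].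
have [|i] := @countable_cover X _ F _ _ hcut; last first.
  move=> nc; exists (D i.1.1), (r i.1.2), (D i.2.1), (D i.2.2), ([set x | local_cut_point x] `&` F i).
  split=> //; first by rewrite invr_gt0.
    by move=> x [_ []].
  by move=> x [_ []].
move=> x [U [xU cU ncU]].
have [e e0 eU] := (nbhs_distP x U).1 xU.
have [n ne] := inv_nat_lt (divr_gt0 e0 (ltr0n R 2)); rewrite -/(r n) in ne.
have r0 : 0 < r n by rewrite invr_gt0.
have [|W [oW Wx cW Wr]] := @lcX x [set z | mdist x z < r n / 4].
  by apply/nbhs_distP; exists (r n / 4) => //; rewrite divr_gt0.
have [i Wi] := Dopen W x oW Wx.
have ix : mdist (D i) x < r n / 4 by rewrite metric_sym; exact: Wr.
have oV : open (V i n) by apply: component_open; exact: open_ball_lt.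
have WV : W `<=` V i n.
  apply: connected_component_max => // w /Wr /= xw.
  by have := mdist_ltD ix xw => /=; lra.
have VU : V i n `<=` U.
  move=> z /connected_component_sub /= iz; apply: eU.
  by have := mdist_ltD (Wr _ Wi) iz; lra.
have [A [B [[oA oB] AB0 AB [a Aa] [b Bb]]]] := local_cut_cuts xU cU ncU oV (WV _ Wx) VU.
have [j Aj] := Dopen A a oA Aa; have [k Bk] := Dopen B b oB Bb.
exists ((i, n), (j, k)) => //; split; first exact: ltW.
by exists A, B; split=> //; exact: WV.
Qed.

End LocalCuts.

Section Split.
Variables (R : realType) (X : metricType R).
Hypothesis cX : compact [set: X].
Variables (A B : X -> set X).

(* An uncountable order with countable initial segments contains a copy of
   omega_1, which is impossible in a separable space. *)
Lemma countable_of_initial_segments (S : set X) :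
  (forall x, S x -> open (B x)) ->
  (forall x y, S x -> S y -> B x y -> A y x) ->
  (forall x y, S x -> S y -> x <> y -> A x y \/ B x y) ->
  (forall x, S x -> ~ A x x) ->
  (forall z, S z -> countable (S `&` A z)) -> countable S.
Proof.
move=> oB BA tot irr cA.
have [[x0 Sx0]|/nonemptyPn->] := pselect (S !=set0); last exact: countable0.
have [D DP] := dense_seq cX x0.
pose Q (i : nat * nat) := S `&` [set z | mdist (D i.1) z < i.2.+1%:R^-1].
have /choice[d dP] i : exists z, S z /\ (Q i !=set0 -> Q i z).
  have [[z Qz]|nQ] := pselect (Q i !=set0); last by exists x0.
  by exists z; split=> //; case: Qz.
(* The points [d i] are dense in [S], and [Z] gathers all that come before or equal one of them. A
   point [z] of [S] outside [Z] has some point of [S] after it, hence, [B z] being open, also some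
   [d i], a contradiction. *)
pose Z := \bigcup_i ([set d i] `|` (S `&` A (d i))).
have cZ : countable Z.
  apply: bigcup_countable => [|i _]; first exact: countableP.
  by apply: countable_union; [exact: countable1|apply: cA; case: (dP i)].
apply: contrapT => ncS.
have out Y : countable Y -> exists2 z, S z & ~ Y z.
  move=> cY; apply: contrapT => h; apply: ncS; apply: countable_subset cY => z Sz.
  by apply: contrapT => nYz; apply: h; exists z.
have [z Sz Zz] := out Z cZ.
have [z' Sz' Zz'] := out ([set z] `|` (S `&` A z))
  (countable_union (countable1 _) (cA _ Sz)).
have Bzz' : B z z'.
  have [| |//] := tot z z' Sz Sz'; first by move=> E; apply: Zz'; left.
  by move=> Azz'; exfalso; apply: Zz'; right.
have [e e0 eP] := (open_distP _).1 (oB z Sz) z' Bzz'.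
have [n ne] := inv_nat_lt (divr_gt0 e0 (ltr0n R 2)).
have n0 : 0 < n.+1%:R^-1 :> R by rewrite invr_gt0.
have [i z'i] := DP z' _ n0.
have [Sd []] := dP (i, n); first by exists z'; split=> //=; rewrite metric_sym.
move=> _ /= id; apply: Zz; exists (i, n) => //; right; split=> //.
apply: BA => //; apply: eP; apply: lt_trans (mdist_ltD z'i id) _.
by rewrite [ltRHS]splitr ltrD.
Qed.

End Split.

(** * The order of the cut points *)

(* For cut points [x] and [y], [B x y] means that [x] comes before [y] on the
   way from [a] to [b], and [A x y] that it comes after. *)
Section CutOrder.
Variables (R : realType) (X : metricType R).
Variables (V E : set X) (a b : X) (A B : X -> set X).
Hypothesis cV : connected V.
Hypothesis cutE : forall x, E x -> cuts V a b x (A x) (B x).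

Lemma cut_disj x z : E x -> A x z -> B x z -> False.
Proof. by move=> /cutE[_ _ h _ _] Az Bz; exact: (h z). Qed.

Lemma cut_sub x z : E x -> A x z \/ B x z -> V z /\ z <> x.
Proof.
move=> /cutE[_ _ _ AB _] h; have : (A x `|` B x) z by [].
by rewrite AB.
Qed.

Lemma cut_cover x z : E x -> V z -> z <> x -> A x z \/ B x z.
Proof.
move=> /cutE[_ _ _ AB _] Vz zx; have : (V `\ x) z by [].
by rewrite -AB.
Qed.

Lemma cut_mem x : E x -> V x. Proof. by move=> /cutE[]. Qed.

Lemma cut_total x y : E x -> E y -> x <> y -> A x y \/ B x y.
Proof. by move=> Ex Ey xy; apply: cut_cover; [|exact: cut_mem|exact/nesym]. Qed.

Lemma cut_irr x : E x -> ~ A x x.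
Proof. by move=> Ex Ax; have [|_] := @cut_sub x x Ex; first by left. Qed.

Lemma cut_clopen O O' : open O -> open O' -> V `<=` O `|` O' -> O `&` O' `<=` set0 ->
  (exists2 z, V z & ~ O z) -> forall z, V z -> ~ O z.
Proof.
move=> oO oO' VO VO0 [z Vz nOz] w Vw Ow.
have [||h|h] := (connected_openP V).1 cV O O' oO oO' => //.
- by move=> u [[_ Ou] O'u]; exact: (VO0 u).
- exact/nOz/h.
- exact: (VO0 w (conj Ow (h w Vw))).
Qed.

(** If instead [x] lay in [B y], then [A x] and [A y] would intersect in a clopen part of [V], with
    complement the union of [B x] and [B y]; it contains [a] but not [x]. *)
Lemma cut_anti x y : E x -> E y -> B x y -> A y x.
Proof.
move=> Ex Ey Bxy; have [Vy yx] := cut_sub Ex (or_intror Bxy).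
have [//|//|Byx] := cut_cover Ey (cut_mem Ex); first exact/nesym.
have [[_ [oA oB] AB0 _ [Aa _]] [_ [oA' oB'] AB0' _ [Aa' _]]] := (cutE Ex, cutE Ey).
exfalso; apply: (@cut_clopen (A x `&` A y) (B x `|` B y) _ _ _ _ _ a).
- exact: openI.
- exact: openU.
- move=> z Vz; have [->|zx] := pselect (z = x); first by right; right.
  have [->|zy] := pselect (z = y); first by right; left.
  have [Az|] := cut_cover Ex Vz zx; last by right; left.
  by have [|] := cut_cover Ey Vz zy; [left|right; right].
- by move=> z [[Az A'z] [Bz|B'z]]; [apply: (AB0 z)|apply: (AB0' z)].
- by exists x; [exact: cut_mem|move=> [/cut_irr]].
- by have [] := cut_sub Ex (or_introl Aa).
- by [].
Qed.

(** The intersection of [A x] and [B y] is clopen in [V], because its complement there is the union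
    of [B x] and [A y]; it misses [x], so it is empty. *)
Lemma cut_mono x y : E x -> E y -> B x y -> A x `<=` A y.
Proof.
move=> Ex Ey Bxy z Az; have Ayx := cut_anti Ex Ey Bxy.
have [Vz zx] := cut_sub Ex (or_introl Az).
have zy : z <> y by move=> zy; apply: (cut_disj Ex Az); rewrite zy.
have [//|Bz] := cut_cover Ey Vz zy; exfalso.
have [[_ [oA oB] AB0 _ [Aa _]] [_ [oA' oB'] AB0' _ [Aa' _]]] := (cutE Ex, cutE Ey).
apply: (@cut_clopen (A x `&` B y) (B x `|` A y) _ _ _ _ _ z) => //.
- exact: openI.
- exact: openU.
- move=> w Vw; have [->|wx] := pselect (w = x); first by right; right.
  have [->|wy] := pselect (w = y); first by right; left.
  have [Aw|] := cut_cover Ex Vw wx; last by right; left.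
  by have [|] := cut_cover Ey Vw wy; [right; right|left].
- by move=> w [[Aw Bw] [Bw'|Aw']]; [apply: (AB0 w)|apply: (AB0' w)].
- by exists x; [exact: cut_mem|move=> [/cut_irr]].
Qed.

Lemma cut_connected (N : set X) x u w : E x -> connected N -> N `<=` V -> N u -> N w ->
  A x u -> B x w -> N x.
Proof.
move=> Ex cN NV Nu Nw Au Bw; apply: contrapT => Nx.
have [_ [oA oB] AB0 _ _] := cutE Ex.
have [||h|h] := (connected_openP N).1 cN (A x) (B x) oA oB.
- by move=> z Nz; apply: cut_cover => //; [exact: NV|move=> zx; apply: Nx; rewrite -zx].
- by move=> z [[_ Az] Bz]; exact: (AB0 z).
- exact: (AB0 w (conj (h w Nw) Bw)).
- exact: (AB0 u (conj Au (h u Nu))).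
Qed.

End CutOrder.

Section CutFamily.
Variables (R : realType) (X : metricType R).
Hypothesis cX : compact [set: X].
Variables (V E : set X) (a b : X) (A B : X -> set X).
Hypothesis cV : connected V.
Hypothesis cutE : forall x, E x -> cuts V a b x (A x) (B x).
Let cutE' x (Ex : E x) : cuts V b a x (B x) (A x) := cuts_sym (cutE Ex).

Lemma cut_anti' x y : E x -> E y -> A x y -> B y x.
Proof. exact: cut_anti cV cutE' _ _. Qed.

Lemma cut_mono' x y : E x -> E y -> B x y -> B y `<=` B x.
Proof. by move=> Ex Ey Bxy; apply: (cut_mono cV cutE') => //; exact: (cut_anti cV cutE). Qed.

(** Without such a [z], the set [S] is the union of the points with countably many predecessors and
    those with countably many successors; both are countable, the second by the reversed order. *)
Lemma cut_split (S : set X) : S `<=` E -> ~ countable S ->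
  exists z, [/\ S z, ~ countable (S `&` A z) & ~ countable (S `&` B z)].
Proof.
move=> SE ncS; apply: contrapT => h; apply: ncS.
have oAB x : E x -> open (A x) /\ open (B x) by move=> /cutE[].
have -> : S = [set z | S z /\ countable (S `&` A z)] `|` [set z | S z /\ countable (S `&` B z)].
  apply/seteqP; split=> z; last by case=> -[].
  move=> Sz; have [cA|ncA] := pselect (countable (S `&` A z)); first by left.
  by right; split=> //; apply: contrapT => ncB; apply: h; exists z.
apply: countable_union.
- apply: (countable_of_initial_segments cX (A := A) (B := B)).
  + by move=> x [/SE/oAB[]].
  + by move=> x y [/SE Ex _] [/SE Ey _]; exact: cut_anti cV cutE _ _ Ex Ey.
  + by move=> x y [/SE Ex _] [/SE Ey _]; exact: cut_total cutE _ _ Ex Ey.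
  + by move=> x [/SE Ex _]; exact: cut_irr cutE _ Ex.
  + by move=> z [_]; apply: countable_subset => x [[]].
- apply: (countable_of_initial_segments cX (A := B) (B := A)).
  + by move=> x [/SE/oAB[]].
  + by move=> x y [/SE Ex _] [/SE Ey _]; exact: cut_anti'.
  + by move=> x y [/SE Ex _] [/SE Ey _]; exact: cut_total cutE' _ _ Ex Ey.
  + by move=> x [/SE Ex _]; exact: cut_irr cutE' _ Ex.
  + by move=> z [_]; apply: countable_subset => x [[]].
Qed.

(** Stronger than the order itself, and dense: a thick pair always has a thick midpoint, while two
    cut points in order may have none between them. *)
Definition thick x y := ~ countable (E `&` B x `&` A y).

Lemma thick_lt x y : E x -> E y -> thick x y -> B x y.
Proof.
move=> Ex Ey; apply: contra_notP => nB.
rewrite (_ : _ `&` _ = set0); first exact: countable0.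
apply/seteqP; split=> // z [[Ez Bz] Az]; apply: nB.
by apply: (cut_mono' Ex Ez Bz); exact: cut_anti'.
Qed.

Lemma thick_mid x y : E x -> E y -> thick x y -> exists z, [/\ E z, thick x z & thick z y].
Proof.
move=> Ex Ey /cut_split[z [[Ez _] _]|z [[[Ez Bz] Az] nA nB]] //.
exists z; split=> //.
  by apply: contra_not nA; apply: countable_subset => w [[[? ?] _] ?].
by apply: contra_not nB; apply: countable_subset => w [[[? ?] ?] ?].
Qed.

(** The invariant is that uncountably many cut points lie after the current one, so that [cut_split]
    can be applied to them again. *)
Lemma thick_seq : ~ countable E ->
  exists z : nat -> X, forall i, E (z i) /\ thick (z i) (z i.+1).
Proof.
move=> ncE.
have /choice[F FP] x : exists y, E x /\ ~ countable (E `&` B x) ->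
    [/\ E y, ~ countable (E `&` B y) & thick x y].
  have [[Ex ncB]|nx] := pselect (E x /\ ~ countable (E `&` B x)); last by exists x.
  have [z [[Ez Bz] nA nB]] := cut_split (@subIsetl _ _ _) ncB.
  exists z => _; split=> //.
  by apply: contra_not nB; apply: countable_subset => w [[]].
have [z0 [Ez0 _ nB0]] := cut_split (@subset_refl _ E) ncE.
have zP i : E (iter i F z0) /\ ~ countable (E `&` B (iter i F z0)).
  by elim: i => // i /FP[].
by exists (fun i => iter i F z0) => i; split; [case: (zP i)|case: (FP _ (zP i))].
Qed.

(** [M n k] is the cut point placed at k/2^n: even indices are inherited from the previous level,
    odd ones are thick midpoints. *)
Lemma dyadic_cuts p q : E p -> E q -> thick p q ->
  exists (Q : set R) (e : R -> X),
   [/\ forall s t, 0 <= s -> s < t -> t <= 1 -> exists2 d, Q d & s < d < t,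
       forall d, Q d -> 0 < d < 1,
       forall d, Q d -> [/\ E (e d), B p (e d) & A q (e d)] &
       forall d d', Q d -> Q d' -> d < d' -> B (e d) (e d')].
Proof.
move=> Ep Eq pq.
have /choice[mid midP] (xy : X * X) : exists z, E xy.1 -> E xy.2 -> thick xy.1 xy.2 ->
    [/\ E z, thick xy.1 z & thick z xy.2].
  have [[Ex Ey xy2]|nxy] := pselect [/\ E xy.1, E xy.2 & thick xy.1 xy.2].
    by have [z zP] := thick_mid Ex Ey xy2; exists z.
  by exists xy.1 => *; exfalso; exact: nxy.
pose M := fix M n k := if n is n'.+1 then
  (if odd k then mid (M n' k./2, M n' k./2.+1) else M n' k./2)
  else if k is 0%N then p else q.
have MP n : [/\ M n 0%N = p, M n (2 ^ n)%N = q &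
    forall k, (k < 2 ^ n)%N -> [/\ E (M n k), E (M n k.+1) & thick (M n k) (M n k.+1)]].
  elim: n => [|n [M0 M1 Mk]]; first by split=> // -[|k].
  split=> //=; first by rewrite expnS mul2n odd_double doubleK.
  move=> k; rewrite expnS mul2n => k2; have kn : (k./2 < 2 ^ n)%N by rewrite ltn_half_double.
  have [E1 E2 t12] := Mk _ kn.
  have [Em tm1 tm2] := midP (_, _) E1 E2 t12.
  have E3 : (uphalf k = odd k + k./2)%N by rewrite uphalf_half.
  by rewrite E3; case: (odd k).
(* Two dyadic numbers are compared by lifting both to a common level, so the fraction chosen to
   define [e d] need not be reduced. *)
have Ml n j k : M (j + n)%N (k * 2 ^ j)%N = M n k.
  elim: j => [|j IH]; first by rewrite muln1.
  by rewrite addSn /= expnS mulnCA mul2n odd_double doubleK.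
have ME n k : (k <= 2 ^ n)%N -> E (M n k).
  have [M0 M1 Mk] := MP n.
  by rewrite leq_eqVlt => /orP[/eqP->|/Mk[]//]; rewrite M1.
have Mlt n k k' : (k < k')%N -> (k' <= 2 ^ n)%N -> B (M n k) (M n k').
  have [_ _ Mk] := MP n.
  elim: k' => // k' IH; rewrite ltnS leq_eqVlt => /orP[/eqP<-|kk'] k'n.
    by have [? ? ?] := Mk _ k'n; exact: thick_lt.
  have [E1 E2 t12] := Mk _ k'n.
  apply: (cut_mono' _ E1 (IH kk' (ltnW k'n))); last exact: thick_lt.
  by apply: ME; apply: leq_trans (ltnW k'n); exact: ltnW.
pose Q := [set d : R | exists nk : nat * nat,
  (0 < nk.2 < 2 ^ nk.1)%N /\ d = nk.2%:R / 2 ^+ nk.1].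
have /choice[e eP] d : exists x, Q d -> exists n k,
    [/\ (0 < k)%N, (k < 2 ^ n)%N, d = k%:R / 2 ^+ n & x = M n k].
  have [[nk [/andP[k0 kn] dE]]|nQ] := pselect (Q d); last by exists p.
  by exists (M nk.1 nk.2) => _; exists nk.1, nk.2.
exists Q, e; split.
- move=> s t s0 st t1.
  have st0 : 0 < t - s by rewrite subr_gt0.
  have [n] := half_pow_lt (@ltr01 R) st0; rewrite mul1r exprVn => ne.
  have n0 : 0 < (2 : R) ^+ n by rewrite exprn_gt0.
  have /andP[h1 h2] := truncn_itv (mulr_ge0 s0 (ltW n0)).
  set k := Num.truncn _ in h1 h2.
  have kt : s < k.+1%:R / 2 ^+ n < t.
    rewrite ltr_pdivlMr// h2/= -natr1 mulrDl mul1r.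
    by move: h1; rewrite -ler_pdivrMr//; lra.
  exists (k.+1%:R / 2 ^+ n) => //; exists (n, k.+1); split=> //=.
  rewrite -(ltr_nat R) natrX; move/andP: kt => [_ /lt_le_trans /(_ t1)].
  by rewrite ltr_pdivrMr// mul1r.
- move=> _ [[n k] /= [/andP[k0 kn] ->]].
  rewrite divr_gt0 ?ltr0n ?exprn_gt0//= ltr_pdivrMr ?exprn_gt0// mul1r.
  by rewrite -natrX ltr_nat.
- move=> d /eP[n [k [k0 kn _ ->]]].
  have [M0 M1 _] := MP n; have Ek := ME n k (ltnW kn).
  split=> //; first by rewrite -M0; apply: Mlt => //; exact: ltnW.
  by apply: (cut_anti cV cutE) => //; rewrite -M1; exact: Mlt.
- move=> d d' /eP[n [k [k0 kn dE ->]]] /eP[n' [k' [k'0 k'n dE' ->]]].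
  rewrite -(Ml n n' k) -(Ml n' n k') [(n + n')%N]addnC dE dE' => dd.
  apply: Mlt; last by rewrite expnD leq_mul2r (ltnW k'n) orbT.
  rewrite -(ltr_nat R) !natrM !natrX.
  by move: dd; rewrite ltr_pdivrMr ?exprn_gt0// mulrAC ltr_pdivlMr ?exprn_gt0.
Qed.

End CutFamily.

(** * The height function *)

Section CutPiece.
Variables (R : realType) (X : metricType R).
Hypothesis cX : compact [set: X].
Hypothesis lcX : locally_connected X.
Variables (y : X) (r : R) (E : set X) (a b : X) (A B : X -> set X).
Let V := connected_component [set z | mdist y z < r] y.
Hypothesis r0 : 0 < r.
Hypothesis Er : forall x, E x -> mdist y x <= r / 4.
Hypothesis cutE : forall x, E x -> cuts V a b x (A x) (B x).
Let cV : connected V := @component_connected _ _ _.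
Let oV : open V := component_open lcX y (open_ball_lt y r).

Lemma component_ball_extend (N : set X) x : connected N -> N `<=` [set z | mdist y z < r] ->
  V x -> N x -> N `<=` V.
Proof.
move=> cN Nr Vx Nx z Nz; apply: connected_component_trans Vx _.
by exists N.
Qed.

Lemma lc_ball x (e : R) : 0 < e -> exists N : set X,
  [/\ open N, N x, connected N & N `<=` [set z | mdist x z < e]].
Proof. by move=> e0; apply: lcX; apply/nbhs_distP; exists e. Qed.

(** Along an increasing sequence [z], some piece between neighbors stays within [r / 2] of [y].
    Otherwise points [w i] of the pieces on the sphere of radius [r / 2] cluster at some [x]; a
    connected neighborhood of [x] of radius [r / 4] joins two of them, so it contains a cut point
    between them, yet cut points are within [r / 4] of [y]. *)
Lemma cut_piece : ~ countable E ->
  exists p q, [/\ E p, E q, thick E A B p q & closure (B p `&` A q) `<=` V].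
Proof.
move=> /(thick_seq cX cV cutE)[z zP].
have zE i : E (z i) by case: (zP i).
have zz i j : (i < j)%N -> B (z i) (z j).
  elim: j => // j IH; rewrite ltnS leq_eqVlt => /orP[/eqP->|/IH ij].
    by apply: (thick_lt cV cutE) => //; case: (zP j).
  apply: (cut_mono' cV cutE _ _ ij) => //.
  by apply: (thick_lt cV cutE) => //; case: (zP j).
suff [i iP] : exists i, B (z i) `&` A (z i.+1) `<=` [set x | mdist y x < r / 2].
  exists (z i), (z i.+1); split=> //; first by case: (zP i).
  move=> x clx; have yx : mdist y x < r.
    have r4 : 0 < r / 4 by rewrite divr_gt0.
    have [w /iP/= yw xw] := (closure_distP _ _).1 clx _ r4.
    by rewrite metric_sym in xw; have := mdist_ltD yw xw; lra.
  have e0 : 0 < r - mdist y x by rewrite subr_gt0.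
  have [N [oN Nx cN Ne]] := lc_ball x e0.
  have [w [[Bw _] Nw]] := clx N (open_nbhs_nbhs (conj oN Nx)).
  apply: (@component_ball_extend N w) => //.
    by move=> u /Ne /= xu; have := metric_triangle y x u; lra.
  by have [] := cut_sub cutE (zE i) (or_intror Bw).
apply: contrapT => /forallNP h.
(* If the piece missed the sphere, its part outside would be clopen in [V] and nonempty, but would
   not contain [z i]. *)
have /choice[w wP] i : exists w, (B (z i) `&` A (z i.+1)) w /\ mdist y w = r / 2.
  apply: contrapT => /forallNP hw; apply: (h i) => x [Bx Ax] /=.
  have [_ [oA oB] AB0 _ _] := cutE (zE i).
  have [_ [oA' oB'] AB0' _ _] := cutE (zE i.+1).
  rewrite ltNge; apply/negP => xr.
  have C w : (B (z i) `&` A (z i.+1)) w -> mdist y w < r / 2 \/ r / 2 < mdist y w.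
    move=> Cw; have [wr|wr|wr] := ltgtP (mdist y w) (r / 2); [by left|by right|].
    by exfalso; exact: (hw w).
  have yz j : mdist y (z j) < r / 2 by have := Er (zE j); have := r0; lra.
  apply: (@cut_clopen _ _ V cV (B (z i) `&` A (z i.+1) `&` [set x | r / 2 < mdist y x])
    (A (z i) `|` B (z i.+1) `|` [set x | mdist y x < r / 2]) _ _ _ _ _ x).
  - by apply: openI; [exact: openI|exact: open_ball_gt].
  - by apply: openU; [exact: openU|exact: open_ball_lt].
  - move=> w Vw; have [->|wi] := pselect (w = z i); first by right; right; exact: yz.
    have [->|wj] := pselect (w = z i.+1); first by right; right; exact: yz.
    have [Aw|Bw] := cut_cover cutE (zE i) Vw wi; first by right; left; left.
    have [Aw'|Bw'] := cut_cover cutE (zE i.+1) Vw wj; last by right; left; right.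
    by have [wr|wr] := C w (conj Bw Aw'); [right; right|left].
  - move=> w [[[Bw Aw] wr] [[Aw'|Bw']|/= wr']]; first exact: (AB0 w).
      exact: (AB0' w).
    by have := lt_trans wr wr'; rewrite ltxx.
  - exists (z i); first exact: (cut_mem cutE).
    by move=> [[Bz _] _]; exact: (cut_irr (fun x Ex => cuts_sym (cutE Ex)) (zE i) Bz).
  - by have [] := cut_sub cutE (zE i) (or_intror Bx).
  - split=> //; have [xr'|//] := C x (conj Bx Ax).
    by move: xr; rewrite leNgt xr'.
have [x xP] := compact_dist_seq cX w.
have xr : mdist y x = r / 2.
  apply/eqP; rewrite eq_le; apply/andP; split; apply/ler_addgt0Pr => e e0;
    have [n _ xn] := xP e 0%N e0; have [_ yn] := wP n.
    by have := metric_triangle y (w n) x; rewrite (metric_sym (w n)); lra.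
  by have := metric_triangle y x (w n); lra.
have r4 : 0 < r / 4 by rewrite divr_gt0.
have [N [oN Nx cN Ne]] := lc_ball x r4.
have [e e0 eN] := (open_distP N).1 oN x Nx.
have [i _ /eN Ni] := xP e 0%N e0; have [j ij /eN Nj] := xP e i.+1 e0.
have [[Bi Ai] _] := wP i; have [[Bj Aj] _] := wP j.
have NV : N `<=` V.
  apply: (@component_ball_extend N (w i)) => //.
    by move=> u /Ne /= xu; have := metric_triangle y x u; lra.
  by have [] := cut_sub cutE (zE i) (or_intror Bi).
have Aij : A (z j) (w i).
  move: ij; rewrite leq_eqVlt => /orP[/eqP<-//|/zz ij].
  by apply: (cut_mono cV cutE _ _ ij).
have Nz := cut_connected cutE (zE j) cN NV Ni Nj Aij Bj.
have := Ne _ Nz; have := Er (zE j) => /=.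
by have := metric_triangle y (z j) x; rewrite (metric_sym (z j)); lra.
Qed.

End CutPiece.

Section Height.
Variables (R : realType) (X : metricType R).

(* A Urysohn-type function on [V]: every gap [s < t] between its values is
   witnessed by a single point [w] that each connected subset of [V] crossing
   the gap has to contain. *)
Definition height (V : set X) (c : X -> R) :=
  [/\ forall x, V x -> 0 <= c x <= 1,
      forall x (e : R), V x -> 0 < e -> exists2 d : R, 0 < d &
        forall z, mdist x z < d -> V z /\ `|c x - c z| < e,
      closure [set x | V x /\ 0 < c x < 1] `<=` V,
      forall s t, 0 <= s -> s < t -> t <= 1 -> exists w, forall N u u',
        connected N -> N `<=` V -> N u -> N u' -> c u <= s -> t <= c u' -> N w &
      forall s t, 0 <= s -> s < t -> t <= 1 -> exists2 x, V x & s < c x < t].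

Lemma height_sym V c : height V c -> height V (fun x => 1 - c x).
Proof.
move=> [c01 cC clV cut dens]; split.
- by move=> x /c01; lra.
- move=> x e Vx e0; have [d d0 dP] := cC x e Vx e0; exists d => // z /dP[Vz].
  by rewrite !ltr_norml => h; split=> //; lra.
- move=> x clx; apply: clV; apply: closureS clx => z [Vz cz]; split=> //; lra.
- move=> s t s0 st t1; have [|||w wP] := cut (1 - t) (1 - s); [lra..|].
  exists w => N u u' cN NV Nu Nu' us ut; apply: (wP N u' u) => //; lra.
- move=> s t s0 st t1; have [|||x Vx xP] := dens (1 - t) (1 - s); [lra..|].
  by exists x => //; lra.
Qed.

Variables (V E : set X) (a b : X) (A B : X -> set X) (p q : X).
Hypothesis oV : open V.
Hypothesis cV : connected V.
Hypothesis cutE : forall x, E x -> cuts V a b x (A x) (B x).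
Hypothesis (Ep : E p) (Eq : E q).
Hypothesis clV : closure (B p `&` A q) `<=` V.
Variables (Q : set R) (e : R -> X).
Hypothesis Qdense : forall s t, 0 <= s -> s < t -> t <= 1 -> exists2 d, Q d & s < d < t.
Hypothesis Q01 : forall d, Q d -> 0 < d < 1.
Hypothesis eE : forall d, Q d -> [/\ E (e d), B p (e d) & A q (e d)].
Hypothesis elt : forall d d', Q d -> Q d' -> d < d' -> B (e d) (e d').

(** [c x] is the supremum of the [d] whose cut point [e d] comes before [x]; 0 is thrown in for
    points that come after none of them. A gap between [s] and [t] is witnessed by any [e d] with s
    < d < t. *)
Lemma height_exists : exists c : X -> R, height V c.
Proof.
have Ee d : Q d -> E (e d) by move=> /eE[].
pose S x := [set d | d = 0 \/ Q d /\ B (e d) x].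
have hS x : has_sup (S x).
  split; first by exists 0; left.
  by exists 1 => d [->|[/Q01 + _]]; lra.
pose c x := sup (S x).
have c_ge x d : Q d -> B (e d) x -> d <= c x.
  by move=> Qd Bd; apply: ub_le_sup; [case: (hS x)|right].
have c0 x : 0 <= c x by apply: ub_le_sup; [case: (hS x)|left].
have c1 x : c x <= 1 by apply: ge_sup; [case: (hS x)|move=> d [->|[/Q01 + _]]; lra].
have c_gt x t : 0 <= t -> t < c x -> exists d, [/\ Q d, t < d & B (e d) x].
  move=> t0 /(sup_gt (hS x).1)[d [->|[Qd Bd]] td]; first by lra.
  by exists d.
have c_le x d : V x -> Q d -> A (e d) x -> c x <= d.
  move=> Vx Qd Ad; apply: ge_sup; first by case: (hS x).
  move=> d' [->|[Qd' Bd']]; first by have := Q01 Qd; lra.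
  rewrite leNgt; apply/negP => dd'.
  have := cut_mono cV cutE (Ee _ Qd) (Ee _ Qd') (elt Qd Qd' dd') Ad.
  by move=> Ad'; exact: (cut_disj cutE (Ee _ Qd') Ad').
have c_lt x t : V x -> t <= 1 -> c x < t -> exists d, [/\ Q d, d < t & A (e d) x].
  move=> Vx t1 ct; have [d Qd /andP[cd dt]] := Qdense (c0 x) ct t1.
  have d1 : d <= 1 by lra.
  (* The second value [d'] covers the case that [x] is itself a chosen cut point: not being in
     [B (e d')], it equals [e d'] or lies in [A (e d')], and both are inside [A (e d)]. *)
  have [d' Qd' /andP[cd' dd']] := Qdense (c0 x) cd d1.
  exists d; split=> //.
  have AB' : ~ B (e d') x by move=> /c_ge-/(_ Qd'); lra.
  have lt' := elt Qd' Qd dd'.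
  have [->|xd'] := pselect (x = e d'); first exact: (cut_anti cV cutE (Ee _ Qd') (Ee _ Qd) lt').
  have [Ad'|//] := cut_cover cutE (Ee _ Qd') Vx xd'.
  exact: (cut_mono cV cutE (Ee _ Qd') (Ee _ Qd) lt').
have c_e d : Q d -> c (e d) = d.
  move=> Qd; have /andP[d0 d1] := Q01 Qd; apply/eqP; rewrite eq_le; apply/andP; split.
    rewrite leNgt; apply/negP => /(c_gt _ _ (ltW d0))[d' [Qd' dd' Bd']].
    apply: (cut_disj cutE (Ee _ Qd') _ Bd').
    exact: (cut_anti cV cutE (Ee _ Qd) (Ee _ Qd') (elt Qd Qd' dd')).
  rewrite leNgt; apply/negP => cd.
  have [d' Qd' /andP[cd' dd']] := Qdense (c0 _) cd (ltW d1).
  by have := c_ge _ _ Qd' (elt Qd' Qd dd'); lra.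
exists c; split.
- by move=> x _; rewrite c0 c1.
- move=> x eta Vx eta0.
  have [d1 d10 d1P] := (open_distP V).1 oV x Vx.
  have [d2 d20 d2P] : exists2 d : R, 0 < d & forall z, mdist x z < d -> c x - eta < c z.
    have [h|h] := leP 0 (c x - eta); last by exists 1 => // z _; have := c0 z; lra.
    have [|d [Qd dc Bd]] := c_gt x _ h; first by rewrite gtrBl.
    have [_ [_ oB] _ _ _] := cutE (Ee _ Qd).
    have [d' d'0 d'P] := (open_distP _).1 oB x Bd.
    by exists d' => // z /d'P /c_ge-/(_ Qd); lra.
  have [d3 d30 d3P] : exists2 d : R, 0 < d & forall z, mdist x z < d -> V z -> c z < c x + eta.
    have [h|h] := leP (c x + eta) 1; last by exists 1 => // z _ _; have := c1 z; lra.
    have [|d [Qd dc Ad]] := c_lt x _ Vx h; first by rewrite ltrDl.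
    have [_ [oA _] _ _ _] := cutE (Ee _ Qd).
    have [d' d'0 d'P] := (open_distP _).1 oA x Ad.
    by exists d' => // z /d'P Az Vz; have := c_le _ _ Vz Qd Az; lra.
  exists (Num.min d1 (Num.min d2 d3)); first by rewrite !lt_min d10 d20.
  move=> z; rewrite !lt_min => /and3P[z1 z2 z3]; have Vz := d1P _ z1; split=> //.
  by rewrite ltr_norml; have := d2P _ z2; have := d3P _ z3 Vz; lra.
- move=> x clx; apply: clV; apply: closureS clx => z [Vz /andP[cz0 cz1]].
  have [d [Qd _ Bd]] := c_gt _ _ (lexx 0) cz0; have [d' [Qd' _ Ad']] := c_lt _ _ Vz (lexx 1) cz1.
  have [_ Bpd _] := eE Qd; have [_ _ Aqd] := eE Qd'; split.
    exact: (cut_mono' cV cutE Ep (Ee _ Qd) Bpd).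
  apply: (cut_mono cV cutE (Ee _ Qd') Eq _ Ad').
  exact: (cut_anti' cV cutE Eq (Ee _ Qd') Aqd).
- move=> s t s0 st t1; have [d Qd /andP[sd dt]] := Qdense s0 st t1.
  exists (e d) => N u u' cN NV Nu Nu' us tu'.
  have Vu := NV _ Nu; have Vu' := NV _ Nu'.
  have d1 : d <= 1 by lra.
  have [d1' [Q1 dd1 A1]] := c_lt u d Vu d1 (le_lt_trans us sd).
  have d0 : 0 <= d by lra.
  have [d2' [Q2 dd2 B2]] := c_gt u' d d0 (lt_le_trans dt tu').
  apply: (cut_connected cutE (Ee _ Qd) cN NV Nu Nu').
    exact: (cut_mono cV cutE (Ee _ Q1) (Ee _ Qd) (elt Q1 Qd dd1)).
  exact: (cut_mono' cV cutE (Ee _ Qd) (Ee _ Q2) (elt Qd Q2 dd2)).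
- move=> s t s0 st t1; have [d Qd sdt] := Qdense s0 st t1.
  by exists (e d); [exact: (cut_mem cutE (Ee _ Qd))|rewrite c_e].
Qed.

End Height.

(** * Uniform local connectedness of closed pieces with at most two boundary points *)

Section UniformLocalConnectedness.
Variables (R : realType) (X : metricType R).
Hypothesis cX : compact [set: X].
Implicit Types (Y M : set X).

(** Pairs violating it ever more closely would cluster at a point, one of whose small connected
    neighborhoods contains such a pair. *)
Lemma peano_unif_locally_connected :
  locally_connected X -> unif_locally_connected [set: X].
Proof.
move=> lcX e e0; apply: contrapT => h.
have /choice[u uP] n : exists u : X * X, mdist u.1 u.2 < n.+1%:R^-1 /\ ~ near_in setT e u.1 u.2.
  apply: contrapT => /forallNP hn; apply: h; exists n.+1%:R^-1; first by rewrite invr_gt0.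
  by move=> x y _ _ xy; apply: contrapT => nxy; exact: (hn (x, y)).
have [x xP] := compact_dist_seq cX (fst \o u).
have e2 : 0 < e / 2 by rewrite divr_gt0.
have [W [oW Wx cW We]] := lc_ball lcX x e2.
have [d d0 dW] := (open_distP W).1 oW x Wx.
have d2 : 0 < d / 2 by rewrite divr_gt0.
have [N Nd] := inv_nat_lt d2.
have [n Nn /= xn] := xP _ N d2; have [un nn] := uP n; apply: nn.
have nd : n.+1%:R^-1 < d / 2.
  by apply: le_lt_trans Nd; rewrite lef_pV2 ?posrE ?ltr0n// ler_nat.
exists W; split=> //.
- by apply: dW; lra.
- by apply: dW; have := mdist_ltD xn (lt_trans un nd); lra.
- move=> v w /We /= xv /We /= xw; rewrite metric_sym in xv.
  by have := mdist_ltD xv xw; lra.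
Qed.

(* A connected set leaves [Y] only through [l] or [r]; if it is too small to
   contain both, its trace on [Y] is still connected. *)
Lemma connected_trace Y M l r : closed Y -> connected M ->
    (forall y, Y y -> y <> l -> y <> r -> exists2 e : R, 0 < e & forall z, mdist y z < e -> Y z) ->
    (M l -> M r -> l = r) -> Y l -> Y r ->
  connected (M `&` Y).
Proof.
move=> clY cM intY lr Yl Yr; apply/connected_openP.
(* When the side [O1] holds all exits that [M] uses, it can absorb the complement of [Y], while [O2]
   shrinks to the interior of [Y]; this separation of the trace extends to [M]. *)
have key O1 O2 : open O1 -> open O2 -> M `&` Y `<=` O1 `|` O2 ->
    M `&` Y `&` O1 `&` O2 `<=` set0 -> (M l -> O1 l) -> (M r -> O1 r) ->
    M `&` Y `<=` O1 \/ M `&` Y `<=` O2.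
  move=> oO1 oO2 MO MO0 lO1 rO1.
  have [||||h|h] := (connected_openP M).1 cM (O1 `|` ~` Y) (O2 `&` Y°).
  - by apply: openU => //; exact: closed_openC.
  - by apply: openI => //; exact: open_interior.
  - move=> z Mz; have [Yz|nYz] := pselect (Y z); last by left; right.
    have [O1z|O2z] := MO z (conj Mz Yz); first by left; left.
    have [zl|zl] := pselect (z = l); first by left; left; rewrite zl; apply: lO1; rewrite -zl.
    have [zr|zr] := pselect (z = r); first by left; left; rewrite zr; apply: rO1; rewrite -zr.
    by right; split=> //; apply/nbhs_distP; exact: intY.
  - move=> z [[Mz [O1z|nYz]] [O2z iYz]]; last exact/nYz/(interior_subset iYz).
    exact: (MO0 z (conj (conj (conj Mz (interior_subset iYz)) O1z) O2z)).
  - by left=> z [Mz Yz]; have [] := h z Mz.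
  - by right=> z [Mz Yz]; have [] := h z Mz.
move=> O1 O2 oO1 oO2 MO MO0.
have MO' : M `&` Y `<=` O2 `|` O1 by rewrite setUC.
have MO0' : M `&` Y `&` O2 `&` O1 `<=` set0 by rewrite -setIA [O2 `&` _]setIC setIA.
have key' : (M l -> O2 l) -> (M r -> O2 r) -> M `&` Y `<=` O1 \/ M `&` Y `<=` O2.
  by move=> h1 h2; have [] := key O2 O1 oO2 oO1 MO' MO0' h1 h2; [right|left].
have [Ml|nMl] := pselect (M l).
  have [O1l|O2l] := MO l (conj Ml Yl).
    by apply: key => // Mr; rewrite -(lr Ml Mr).
  by apply: key' => // Mr; rewrite -(lr Ml Mr).
have [Mr|nMr] := pselect (M r); last by apply: key.
by have [O1r|O2r] := MO r (conj Mr Yr); [apply: key|apply: key'].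
Qed.

Lemma unif_locally_connected_trace Y l r : unif_locally_connected [set: X] -> closed Y ->
    (forall y, Y y -> y <> l -> y <> r -> exists2 e : R, 0 < e & forall z, mdist y z < e -> Y z) ->
    Y l -> Y r ->
  unif_locally_connected Y.
Proof.
move=> uX clY intY Yl Yr e e0.
(* A set of diameter at most [e'] cannot contain both [l] and [r] unless they coincide. *)
have [e' [e'0 e'e lr]] : exists e' : R, [/\ 0 < e', e' <= e & l <> r -> e' < mdist l r].
  have [lr|/eqP lr] := pselect (l = r); first by exists e.
  have d0 : 0 < mdist l r by rewrite mdist_gt0.
  exists (Num.min e (mdist l r / 2)); rewrite lt_min e0 divr_gt0// ge_min lexx/=.
  by split=> // _; rewrite gt_min; apply/orP; right; lra.
have [d d0 dP] := uX e' e'0; exists d => // x y Yx Yy xy.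
have [M [cM _ Mx My Me]] := dP x y I I xy.
exists (M `&` Y); split=> //.
- apply: connected_trace clY cM intY _ Yl Yr => Ml Mr.
  by apply: contrapT => /lr; rewrite ltNge Me.
- by move=> u v [Mu _] [Mv _]; apply: le_trans e'e; exact: Me.
Qed.

Lemma unif_locally_connected_component Y x :
  unif_locally_connected Y -> unif_locally_connected (connected_component Y x).
Proof.
move=> uY e e0; have [d d0 dP] := uY e e0; exists d => // u v Cu Cv uv.
have [M [cM MY Mu Mv Me]] := dP u v (connected_component_sub Cu) (connected_component_sub Cv) uv.
exists M; split=> // z Mz; apply: connected_component_trans Cu _.
by exists M.
Qed.

End UniformLocalConnectedness.

(** * One-sided limits at a given height *)

Section Limits.
Variables (R : realType) (X : metricType R).
Hypothesis cX : compact [set: X].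
Hypothesis lcX : locally_connected X.
Variables (V : set X).
Hypothesis oV : open V.

(* Two distinct cluster points would give two disjoint connected sets containing
   points of alternating heights, hence a common point by the gap property. *)
Lemma left_limit (c : X -> R) t : height V c -> 0 < t -> t <= 1 -> exists l,
  [/\ V l, c l = t & forall e : R, 0 < e -> exists2 d : R, 0 < d &
     forall x, V x -> t - d < c x -> c x < t -> mdist l x < e].
Proof.
move=> [c01 cC clV cut dens] t0 t1.
(* a sequence of points whose heights increase to [t] clusters inside [V] *)
have clus (x : nat -> X) : (forall n, [/\ V (x n), 0 < c (x n), t - n.+1%:R^-1 < c (x n) & c (x n) < t]) ->
    exists y, [/\ V y, forall e N, 0 < e -> exists2 n, (N <= n)%N & mdist y (x n) < e &
      forall N s, open N -> N y -> s < t -> exists n, N (x n) /\ s < c (x n)].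
  move=> xP; have [y yP] := compact_dist_seq cX x; exists y; split=> //.
    apply: clV; apply/closure_distP => e e0; have [n _ yn] := yP e 0%N e0.
    by exists (x n) => //; have [Vx c0 _ ct] := xP n; split=> //; rewrite c0 /=; exact: lt_le_trans t1.
  move=> N s oN Ny st; have [e e0 eN] := (open_distP N).1 oN y Ny.
  have [m ms] : exists n : nat, n.+1%:R^-1 < t - s by apply: inv_nat_lt; rewrite subr_gt0.
  have [n mn /eN Nx] := yP e m e0; exists n; split=> //.
  have [_ _ h _] := xP n; apply: lt_trans h; rewrite ltrBrDr addrC -ltrBrDr.
  by apply: le_lt_trans ms; rewrite lef_pV2 ?posrE ?ltr0n// ler_nat.
have low n : 0 <= Num.max 0 (t - n.+1%:R^-1) /\ Num.max 0 (t - n.+1%:R^-1) < t.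
  by rewrite le_max lexx gt_max t0 gtrBl invr_gt0 ltr0n.
have /choice[x xP] n : exists x, [/\ V x, 0 < c x, t - n.+1%:R^-1 < c x & c x < t].
  have [h0 ht] := low n; have [x Vx] := dens _ _ h0 ht t1.
  by rewrite gt_max => /andP[/andP[? ?] ?]; exists x.
have [l [Vl lP lO]] := clus x xP; exists l; split=> //.
  apply/eqP; rewrite eq_le; apply/andP; split; apply/ler_addgt0Pr => e e0.
    have [d d0 dP] := cC l e Vl e0; have [n _ /dP[_]] := lP d 0%N d0.
    by have [_ _ _ h] := xP n; rewrite ltr_norml; lra.
  have e2 : 0 < e / 2 by rewrite divr_gt0.
  have [d d0 dP] := cC l _ Vl e2.
  have [||n [/= /dP[_ cn] tn]] := lO [set z | mdist l z < d] (t - e / 2) (open_ball_lt l d).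
  - by rewrite /= mdistxx.
  - by rewrite gtrBl.
  by move: cn; rewrite ltr_norml; lra.
move=> e e0; apply: contrapT => h.
have /choice[y yP] n : exists y, [/\ V y, 0 < c y, t - n.+1%:R^-1 < c y & c y < t] /\ e <= mdist l y.
  have d0 : 0 < Num.min t n.+1%:R^-1 by rewrite lt_min t0 invr_gt0 ltr0n.
  apply: contrapT => /forallNP hn; apply: h; exists (Num.min t n.+1%:R^-1) => //.
  move=> y Vy; rewrite ltrBlDr -ltrBlDl lt_min => /andP[y1 y2] yt.
  rewrite ltNge; apply/negP => ly; apply: (hn y); split=> //; split=> //.
    by move: y1; rewrite gtrBl.
  by rewrite ltrBlDr -ltrBlDl.
have [z [Vz zP zO]] := clus y (fun n => (yP n).1).
have lz : e <= mdist l z.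
  apply/ler_addgt0Pr => eta eta0; have [n _ zn] := zP eta 0%N eta0; have [_ ly] := yP n.
  by have := metric_triangle l z (y n); lra.
have e2 : 0 < e / 2 by rewrite divr_gt0.
have sub x' : V x' -> exists N, [/\ open N, N x', connected N, N `<=` V & N `<=` [set w | mdist x' w < e / 2]].
  move=> Vx'; have [d d0 dV] := (open_distP V).1 oV x' Vx'.
  have m0 : 0 < Num.min d (e / 2) by rewrite lt_min d0.
  have [N [oN Nx cN Nm]] := lc_ball lcX x' m0; exists N; split=> //.
    by move=> w /Nm /=; rewrite lt_min => /andP[/dV].
  by move=> w /Nm /=; rewrite lt_min => /andP[].
have [N1 [oN1 N1l cN1 N1V N1e]] := sub l Vl; have [N2 [oN2 N2z cN2 N2V N2e]] := sub z Vz.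
have ct n : c (x n) < t by case: (xP n).
have ct' n : c (y n) < t by case: (yP n) => -[].
have c0' n : 0 < c (y n) by case: (yP n) => -[].
have [n1 [Nn1 _]] := lO N1 0 oN1 N1l t0.
have [n2 [Nn2 c12]] := zO N2 _ oN2 N2z (ct n1).
have [n3 [Nn3 c23]] := lO N1 _ oN1 N1l (ct' n2).
have [n4 [Nn4 c34]] := zO N2 _ oN2 N2z (ct n3).
(* This one gap is crossed by [N1] from [x n1] to [x n3] and by [N2] from [y n2] to [y n4], so its
   witness lies in both. *)
have [|w wP] := cut (c (y n2)) (c (x n3)) (ltW (c0' n2)) c23.
  by apply: ltW; exact: lt_le_trans (ct n3) t1.
have N1w := wP N1 _ _ cN1 N1V Nn1 Nn3 (ltW c12) (lexx _).
have N2w := wP N2 _ _ cN2 N2V Nn2 Nn4 (lexx _) (ltW c34).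
have := N1e _ N1w; have := N2e _ N2w => /=; rewrite (metric_sym z) => zw lw.
by have := mdist_ltD lw zw; lra.
Qed.

End Limits.

(** * Fibers of the height and the remaining closed set *)

Section Fibers.
Variables (R : realType) (X : metricType R).
Hypothesis cX : compact [set: X].
Hypothesis kX : connected [set: X].
Hypothesis lcX : locally_connected X.
Variables (V : set X) (c : X -> R).
Hypothesis oV : open V.
Hypothesis cV : connected V.
Hypothesis hc : height V c.

Definition from_left t l := [/\ V l, c l = t & forall e : R, 0 < e ->
  exists2 d : R, 0 < d & forall x, V x -> t - d < c x -> c x < t -> mdist l x < e].

Definition from_right t r := [/\ V r, c r = t & forall e : R, 0 < e ->
  exists2 d : R, 0 < d & forall x, V x -> t < c x -> c x < t + d -> mdist r x < e].

Lemma from_leftE t : 0 < t <= 1 -> exists l, from_left t l.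
Proof. by move=> /andP[t0 t1]; exact: left_limit cX lcX _ oV _ _ hc t0 t1. Qed.

Lemma from_rightE t : 0 <= t < 1 -> exists r, from_right t r.
Proof.
move=> /andP[t0 t1].
have [||r [Vr cr h]] := left_limit cX lcX oV (height_sym hc) (t := 1 - t); [lra..|].
exists r; split=> //; first by lra.
move=> e /h[d d0 dP]; exists d => // x Vx tc ct; apply: dP => //; lra.
Qed.

(** Points with height just below [t] are all close to [l], hence stay away from [y]. *)
Lemma from_left_interior t l y : from_left t l -> V y -> c y = t -> y <> l ->
  exists2 e : R, 0 < e & forall z, mdist y z < e -> V z /\ t <= c z.
Proof.
move=> [_ _ h] Vy cy /nesym/separate_points[e e0 eP].
have [d d0 dP] := h e e0; have [_ cC _ _ _] := hc; have [d' d'0 d'P] := cC y d Vy d0.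
exists (Num.min d' e); first by rewrite lt_min d'0.
move=> z; rewrite lt_min => /andP[/d'P[Vz cz] yz]; split=> //.
rewrite leNgt; apply/negP => zt; apply: (eP z) => //; apply: dP => //.
by move: cz; rewrite cy ltr_norml; lra.
Qed.

Lemma from_right_interior t r y : from_right t r -> V y -> c y = t -> y <> r ->
  exists2 e : R, 0 < e & forall z, mdist y z < e -> V z /\ c z <= t.
Proof.
move=> [_ _ h] Vy cy /nesym/separate_points[e e0 eP].
have [d d0 dP] := h e e0; have [_ cC _ _ _] := hc; have [d' d'0 d'P] := cC y d Vy d0.
exists (Num.min d' e); first by rewrite lt_min d'0.
move=> z; rewrite lt_min => /andP[/d'P[Vz cz] yz]; split=> //.
rewrite leNgt; apply/negP => zt; apply: (eP z) => //; apply: dP => //.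
by move: cz; rewrite cy ltr_norml; lra.
Qed.

Definition fiber t := [set x | V x /\ c x = t].

Section Fiber.
Variables (t : R) (l r : X).
Hypothesis t01 : 0 < t < 1.
Hypothesis ll : from_left t l.
Hypothesis rr : from_right t r.

Lemma fiber_left : fiber t l. Proof. by have [? ? _] := ll. Qed.
Lemma fiber_right : fiber t r. Proof. by have [? ? _] := rr. Qed.

Lemma fiber_closed : closed (fiber t).
Proof.
have [_ cC clV _ _] := hc; move=> x clx.
have Vx : V x.
  by apply: clV; apply: closureS clx => z [Vz cz]; split=> //; rewrite cz.
split=> //; apply/eqP; rewrite -subr_eq0 -normr_eq0 eq_le normr_ge0 andbT.
apply/ler_addgt0Pr => e e0; rewrite add0r.
have [d d0 dP] := cC x e Vx e0; have [z [_ <-] xz] := (closure_distP _ _).1 clx d d0.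
by have [_ /ltW] := dP z xz.
Qed.

Lemma fiber_interior y : fiber t y -> y <> l -> y <> r ->
  exists2 e : R, 0 < e & forall z, mdist y z < e -> fiber t z.
Proof.
move=> [Vy cy] yl yr; have [e e0 eP] := from_left_interior ll Vy cy yl.
have [e' e'0 e'P] := from_right_interior rr Vy cy yr.
exists (Num.min e e'); first by rewrite lt_min e0.
move=> z; rewrite lt_min => /andP[/eP[Vz z1] /e'P[_ z2]]; split=> //.
by apply/eqP; rewrite eq_le z1 z2.
Qed.

Let lower : open [set x | V x /\ c x < t].
Proof.
have [_ cC _ _ _] := hc; apply/open_distP => x [Vx cx].
have d0 : 0 < t - c x by rewrite subr_gt0.
have [d d'0 dP] := cC x _ Vx d0; exists d => // z /dP[Vz cz]; split=> //.
by move: cz; rewrite ltr_norml; lra.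
Qed.

Let upper : open [set x | V x /\ t < c x].
Proof.
have [_ cC _ _ _] := hc; apply/open_distP => x [Vx cx].
have d0 : 0 < c x - t by rewrite subr_gt0.
have [d d'0 dP] := cC x _ Vx d0; exists d => // z /dP[Vz cz]; split=> //.
by move: cz; rewrite ltr_norml; lra.
Qed.

(** A separation of the fiber with [l] and [r] on different sides would extend to [V], by adding the
    lower heights to one side and the upper heights to the other; with [l] and [r] on the same side
    it would extend to [X]. *)
Lemma fiber_connected : connected (fiber t).
Proof.
have [_ _ _ _ dens] := hc.
have [lr|lr] := pselect (l = r).
  rewrite -[fiber t]setTI.
  exact: (connected_trace fiber_closed kX fiber_interior (fun _ _ => lr) fiber_left fiber_right).
apply/connected_openP => O1 O2 oO1 oO2 FO FO0.
pose U1 := [set x | V x /\ c x <= t]°; pose U2 := [set x | V x /\ t <= c x]°.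
have oU1 : open U1 := @open_interior _ _; have oU2 : open U2 := @open_interior _ _.
have F1 y : fiber t y -> y <> r -> U1 y.
  by move=> [Vy cy] yr; apply/nbhs_distP; exact: from_right_interior rr Vy cy yr.
have F2 y : fiber t y -> y <> l -> U2 y.
  by move=> [Vy cy] yl; apply/nbhs_distP; exact: from_left_interior ll Vy cy yl.
have /andP[t0 t1] := t01.
have [x1 Vx1 /andP[_ x1t]] := dens 0 t (lexx _) t0 (ltW t1).
have [x2 Vx2 /andP[tx2 _]] := dens t 1 (ltW t0) t1 (lexx _).
have ltle (u v : R) : u < v -> v <= u -> False by move=> uv; rewrite leNgt uv.
(* if the limit points were separated, so would be the sets below and above [t] in [V] *)
have split2 P1 P2 : open P1 -> open P2 -> fiber t `<=` P1 `|` P2 ->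
    fiber t `&` P1 `&` P2 `<=` set0 -> P1 l -> P2 r -> False.
  move=> oP1 oP2 FP FP0 P1l P2r.
  have [||||h|h] := (connected_openP V).1 cV ([set x | V x /\ c x < t] `|` (P1 `&` U1))
      ([set x | V x /\ t < c x] `|` (P2 `&` U2)).
  - by apply: openU => //; exact: openI.
  - by apply: openU => //; exact: openI.
  - move=> z Vz; have [zt|zt|zt] := ltgtP (c z) t; [by left; left|by right; left|].
    have Fz : fiber t z by [].
    have [P1z|P2z] := FP z Fz; [left; right|right; right]; split=> //.
      by apply: F1 => // zr; apply: (FP0 z); split; [split|rewrite zr].
    by apply: F2 => // zl; apply: (FP0 z); split=> //; split=> //; rewrite zl.
  - move=> z [[Vz [[_ z1]|[P1z /interior_subset[_ z1]]]] [[_ z2]|[P2z /interior_subset[_ z2]]]].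
    + exfalso; exact: (ltle _ _ z1 (ltW z2)).
    + exfalso; exact: (ltle _ _ z1 z2).
    + exfalso; exact: (ltle _ _ z2 z1).
    + by apply: (FP0 z); split=> //; split=> //; split=> //; apply/eqP; rewrite eq_le z1 z2.
  - have [[_ /ltW x2t]|[_ /interior_subset[_ x2t]]] := h _ Vx2; exact: (ltle _ _ tx2 x2t).
  - have [[_ /ltW tx1]|[_ /interior_subset[_ tx1]]] := h _ Vx1; exact: (ltle _ _ x1t tx1).
have FO' : fiber t `<=` O2 `|` O1 by rewrite setUC.
have FO0' : fiber t `&` O2 `&` O1 `<=` set0 by rewrite -setIA [O2 `&` _]setIC setIA.
have same P1 P2 : open P1 -> open P2 -> fiber t `<=` P1 `|` P2 ->
    fiber t `&` P1 `&` P2 `<=` set0 -> P1 l -> P1 r -> fiber t `<=` P1.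
  move=> oP1 oP2 FP FP0 P1l P1r.
  have [||||h|h] := (connected_openP setT).1 kX (P1 `|` ~` fiber t) (P2 `&` (fiber t)°).
  - by apply: openU => //; apply: closed_openC; exact: fiber_closed.
  - by apply: openI => //; exact: open_interior.
  - move=> z _; have [Fz|nFz] := pselect (fiber t z); last by left; right.
    have [P1z|P2z] := FP z Fz; first by left; left.
    have [zl|zl] := pselect (z = l); first by left; left; rewrite zl.
    have [zr|zr] := pselect (z = r); first by left; left; rewrite zr.
    by right; split=> //; apply/nbhs_distP; exact: fiber_interior.
  - move=> z [[_ [P1z|nFz]] [P2z iFz]]; last exact/nFz/(interior_subset iFz).
    exact: (FP0 z (conj (conj (interior_subset iFz) P1z) P2z)).
  - by move=> z Fz; have [] := h z I.
  - by exfalso; have [P2l _] := h l I; exact: (FP0 l (conj (conj fiber_left P1l) P2l)).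
have [O1l|O2l] := FO l fiber_left; have [O1r|O2r] := FO r fiber_right.
- by left; exact: (same O1 O2).
- by exfalso; exact: (split2 O1 O2).
- by exfalso; exact: (split2 O2 O1).
- by right; exact: (same O2 O1).
Qed.

Lemma fiber_path : exists g : R -> X,
  [/\ forall e : R, 0 < e -> exists2 d : R, 0 < d &
        forall s t, `|s - t| < d -> mdist (g s) (g t) < e,
      forall s, s <= 0 -> g s = l, forall s, 1 <= s -> g s = r,
      forall s, fiber t (g s) & forall x, fiber t x -> exists s, g s = x].
Proof.
apply: peano_path => //; [exact: fiber_closed|exact: fiber_connected| |exact: fiber_left|exact: fiber_right].
apply: (unif_locally_connected_trace _ fiber_closed fiber_interior fiber_left fiber_right).
exact: peano_unif_locally_connected.
Qed.

(** Only [l] and [r] can fail to be interior points, and a connected set of at most two points is a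
    single point. *)
Lemma fiber_singleton : (forall e x, fiber t x -> 0 < e -> ~ forall z, mdist x z < e -> fiber t z) ->
  forall x, fiber t x -> x = l.
Proof.
move=> nint.
have Flr x : fiber t x -> x = l \/ x = r.
  move=> Fx; apply: contrapT => /not_orP[xl xr].
  have [e e0 eP] := fiber_interior Fx xl xr.
  exact: nint Fx e0 eP.
suff lr : l = r by move=> x /Flr[|->].
apply: contrapT => /separate_points[e e0 eP].
have [||h|h] := (connected_openP _).1 fiber_connected _ _ (open_ball_lt l e) (open_ball_lt r e).
- by move=> x /Flr[->|->]; [left|right]; rewrite /= mdistxx.
- by move=> x [[_ /eP]].
- by apply: (eP r) => //; [exact: h fiber_right|rewrite mdistxx].
- by apply: (eP l) => //; [rewrite mdistxx|exact: h fiber_left].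
Qed.

End Fiber.

Definition rest := ~` [set x | V x /\ 0 < c x < 1].

Lemma rest_closed : closed rest.
Proof.
apply: open_closedC; have [_ cC _ _ _] := hc; apply/open_distP => x [Vx cx].
have d0 : 0 < Num.min (c x) (1 - c x) by rewrite lt_min; lra.
have [d d'0 dP] := cC x _ Vx d0; exists d => // z /dP[Vz].
by rewrite lt_min !ltr_norml => cz; split=> //; lra.
Qed.

Section Rest.
Variables (r0 l1 : X).
Hypothesis hr : from_right 0 r0.
Hypothesis hl : from_left 1 l1.

Lemma rest_right : rest r0. Proof. by case: hr => _ cr _ [_]; rewrite cr ltxx. Qed.
Lemma rest_left : rest l1. Proof. by case: hl => _ cl _ [_]; rewrite cl ltxx andbF. Qed.

Lemma rest_interior y : rest y -> y <> r0 -> y <> l1 ->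
  exists2 e : R, 0 < e & forall z, mdist y z < e -> rest z.
Proof.
move=> Ry yr yl; have [c01 _ clV _ _] := hc; have [Vy|nVy] := pselect (V y).
  have [c0|c1] : c y = 0 \/ c y = 1.
    have /andP[y0 y1] := c01 y Vy; have [cy0|cy0] := ltP 0 (c y).
      right; apply/eqP; rewrite eq_le y1 leNgt; apply/negP => cy1; apply: Ry.
      by split=> //; rewrite cy0.
    by left; apply/eqP; rewrite eq_le y0 cy0.
  - have [e e0 eP] := from_right_interior hr Vy c0 yr; exists e => // z /eP[_ z0] [_]; lra.
  - have [e e0 eP] := from_left_interior hl Vy c1 yl; exists e => // z /eP[_ z0] [_]; lra.
apply: contrapT => h; apply: nVy; apply: clV; apply/closure_distP => e e0.
apply: contrapT => he; apply: h; exists e => // z yz Vz; apply: he.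
by exists z.
Qed.

Lemma rest_unif_locally_connected : unif_locally_connected rest.
Proof.
apply: (unif_locally_connected_trace _ rest_closed rest_interior rest_right rest_left).
exact: peano_unif_locally_connected.
Qed.

(** A component avoiding [r0] and [l1] consists of interior points, so it is open by uniform local
    connectedness; being closed too, it would be all of [X]. *)
Lemma rest_component x : rest x ->
  connected_component rest r0 x \/ connected_component rest l1 x.
Proof.
move=> Rx; apply: contrapT => /not_orP[nr nl].
pose K := connected_component rest x.
have [d d0 dP] := rest_unif_locally_connected ltr01.
have oK : open K.
  apply/open_distP => y Ky; have Ry := connected_component_sub Ky.
  have [||e e0 eP] := rest_interior Ry.
  - by move=> yr; apply: nr; apply: connected_component_sym; rewrite -yr.
  - by move=> yl; apply: nl; apply: connected_component_sym; rewrite -yl.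
  exists (Num.min d e); first by rewrite lt_min d0.
  move=> z; rewrite lt_min => /andP[yd /eP Rz].
  have [M [cM MR My Mz _]] := dP y z Ry Rz yd.
  by apply: connected_component_trans Ky _; exists M.
have Kx : K x by exact: connected_component_refl.
have KT : K = setT.
  apply: kX; first by exists x.
    by exists K => //; rewrite setTI.
  exists K; last by rewrite setTI.
  exact/component_closed/rest_closed.
apply: nr; apply: connected_component_sym.
by rewrite -/(K r0) KT.
Qed.

(** A loop, since at the heights 0 and 1 neighboring fibers approach from one side only. *)
Lemma rest_path y : rest y -> exists g : R -> X,
  [/\ forall e : R, 0 < e -> exists2 d : R, 0 < d &
        forall s t, `|s - t| < d -> mdist (g s) (g t) < e,
      forall s, s <= 0 -> g s = y, forall s, 1 <= s -> g s = y,
      forall s, rest (g s) & forall x, connected_component rest y x -> exists s, g s = x].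
Proof.
move=> Ry; have Cy := connected_component_refl Ry.
have [|||g [g1 g2 g3 g4 g5]] := @peano_path R X cX (connected_component rest y) y y _ _ _ Cy Cy.
- exact/component_closed/rest_closed.
- exact: component_connected.
- exact/unif_locally_connected_component/rest_unif_locally_connected.
by exists g; split=> // s; exact: connected_component_sub (g4 s).
Qed.

End Rest.

End Fibers.

(** * Three contracting maps *)

Section Tent.
Variable R : realType.

Definition tent (s : R) : R := Num.max 0 (1 - `|2 * s - 1|).

Lemma tent_lip s t : `|tent s - tent t| <= 2 * `|s - t|.
Proof.
wlog h : s t / tent t <= tent s.
  by move=> W; have [/W//|/ltW/W] := leP (tent t) (tent s); rewrite distrC [`|t - s|]distrC.
rewrite ger0_norm ?subr_ge0//; rewrite /tent in h *.
have : `|2 * t - 1| <= `|2 * s - 1| + 2 * `|s - t|.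
  have -> : 2 * `|s - t| = `|2 * t - 2 * s| by rewrite -mulrBr normrM distrC (@ger0_norm _ 2).
  by have -> : 2 * t - 1 = (2 * s - 1) + (2 * t - 2 * s) by [lra]; exact: ler_normD.
have := normr_ge0 (s - t).
by rewrite /Num.max; case: ltP => ?; case: ltP => ?; lra.
Qed.

Lemma tent_le0 s : s <= 0 -> tent s = 0.
Proof. by move=> s0; apply/max_idPl; rewrite ler0_norm; lra. Qed.

Lemma tent_ge1 s : 1 <= s -> tent s = 0.
Proof. by move=> s1; apply/max_idPl; rewrite ger0_norm; lra. Qed.

Lemma tent_half s : 0 <= s <= 1 -> tent (s / 2) = s.
Proof.
move=> /andP[s0 s1]; rewrite /tent (_ : 2 * (s / 2) - 1 = s - 1); last by lra.
by rewrite ler0_norm; [rewrite opprB subKr; apply/max_idPr|lra].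
Qed.

Lemma tent_bound s : 0 <= tent s <= 1.
Proof. by rewrite le_max lexx ge_max ler01/= gerBl. Qed.

End Tent.

Section Contraction.
Variables (R : realType) (X : metricType R).
Hypothesis cX : compact [set: X].

Lemma unif_continuous_segment (psi : R -> X) (K e : R) : 0 < e ->
  (forall s (e : R), 0 < e -> exists2 d : R, 0 < d &
        forall s', `|s - s'| < d -> mdist (psi s) (psi s') < e) ->
  exists2 d : R, 0 < d & forall s t, 0 <= s <= K -> 0 <= t <= K -> `|s - t| < d ->
    mdist (psi s) (psi t) < e.
Proof.
move=> e0 cpsi; apply: contrapT => h.
have /choice[u uP] n : exists u : R * R, [/\ 0 <= u.1 <= K, `|u.1 - u.2| < n.+1%:R^-1 &
    e <= mdist (psi u.1) (psi u.2)].
  apply: contrapT => /forallNP hn; apply: h; exists n.+1%:R^-1; first by rewrite invr_gt0.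
  by move=> s t sK tK st; rewrite ltNge; apply/negP => est; apply: (hn (s, t)).
have uK n : `[0, K]%classic (u n).1 by have [+ _ _] := uP n; rewrite /= in_itv.
have [s _ sP] := compact_seq (@segment_compact R 0 K) uK.
have e2 : 0 < e / 2 by rewrite divr_gt0.
have [d d0 dP] := cpsi s _ e2.
have d2 : 0 < d / 2 by rewrite divr_gt0.
have [N Nd] := inv_nat_lt d2; have [n Nn] := sP _ N d2.
rewrite /ball/= => sn; have [_ un] := uP n.
have nd : n.+1%:R^-1 < d / 2.
  by apply: le_lt_trans Nd; rewrite lef_pV2 ?posrE ?ltr0n// ler_nat.
rewrite leNgt => /negP; apply.
have s1 : mdist (psi s) (psi (u n).1) < e / 2 by apply: dP; lra.
have s2 : mdist (psi s) (psi (u n).2) < e / 2.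
  apply: dP; apply: le_lt_trans (ler_distD (u n).1 _ _) _.
  by rewrite [ltRHS]splitr ltrD//; exact: lt_trans un nd.
by rewrite metric_sym in s1; rewrite [ltRHS]splitr; exact: mdist_ltD s1 s2.
Qed.

Lemma diameter_lt (A : set X) (e : R) : 0 < e ->
  (forall x y, A x -> A y -> mdist x y <= e / 2) -> (diameter A < e%:E)%E.
Proof.
move=> e0 h; apply: (@le_lt_trans _ _ (e / 2)%:E).
  by apply: ge_ereal_sup => _ [[x y] [Ax Ay] <-]; rewrite lee_fin; exact: h.
by rewrite lte_fin; lra.
Qed.

(* The maps [psi (lam (i + c x))], [i < 3], factor through [c]; since
   [c \o psi] is 2-Lipschitz and [2 lam < 1], composites shrink the values of [c]. *)
Lemma three_map_fractal (psi : R -> X) (c : X -> R) :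
  (forall s (e : R), 0 < e -> exists2 d : R, 0 < d &
        forall s', `|s - s'| < d -> mdist (psi s) (psi s') < e) ->
  (forall x (e : R), 0 < e -> exists2 d : R, 0 < d &
        forall y, mdist x y < d -> `|c x - c y| < e) ->
  (forall x, 0 <= c x <= 1) ->
  (forall t, 0 <= t <= 1 -> exists x, c x = t) ->
  (forall s t, `|c (psi s) - c (psi t)| <= 2 * `|s - t|) ->
  (forall x, exists2 s, 0 <= s <= 5 / 4 & psi s = x) ->
  exists f : nat -> X -> X, witnessing_family [set f i | i in `I_3].
Proof.
move=> cpsi cc c01 csurj clip psisurj.
(* One third of 5/4; together with the Lipschitz constant 2 it gives the factor 5/6. *)
pose lam : R := 5 / 12.
pose f (i : nat) x := psi (lam * (i%:R + c x)).
have fr (i : nat) x : (i < 3)%N -> 0 <= lam * (i%:R + c x) <= 5 / 4.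
  move=> i3; have i2 : (i%:R : R) <= 2 by rewrite ler_nat.
  have i0 : (0 : R) <= i%:R by [].
  by have := c01 x; rewrite /lam; lra.
have farg (i : nat) x y : `|lam * (i%:R + c x) - lam * (i%:R + c y)| = lam * `|c x - c y|.
  by rewrite -mulrBr normrM opprD addrACA subrr add0r ger0_norm// /lam; lra.
exists f; split.
- exact/finite_image/finite_II.
- move=> _ [i i3 <-] x.
  move=> U /nbhs_distP[e e0 eU]; have [d d0 dP] := cpsi (lam * (i%:R + c x)) e e0.
  have [d' d'0 d'P] := cc x d d0; apply/nbhs_distP; exists d' => // y /d'P xy.
  apply: eU; apply: dP; rewrite farg; apply: le_lt_trans xy.
  by rewrite ler_piMl// /lam; lra.
- have words n : forall g, iter_maps [set f i | i in `I_3] n g ->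
      forall x y, `|c (g x) - c (g y)| <= (5 / 6) ^+ n.
    elim: n => [|n IH] g [s sF <-] x y.
      by rewrite big_ord0 expr0; have := c01 x; have := c01 y; rewrite ler_norml; lra.
    rewrite big_ord_recl /=; have [i i3 <-] := sF ord0.
    apply: le_trans (clip _ _) _; rewrite farg exprS.
    set w := \big[_/_]_(_ < n) _.
    have : `|c (w x) - c (w y)| <= (5 / 6) ^+ n by apply: IH; exists (fun j => s (lift ord0 j)).
    by rewrite /lam; lra.
  move=> e e0; have e2 : 0 < e / 2 by rewrite divr_gt0.
  have [d d0 dP] := unif_continuous_segment (5 / 4) e2 cpsi.
  have [n nd] : exists n : nat, (5 / 6 : R) ^+ n < d.
    have [n] := half_pow_lt (@ltr01 R) d0; rewrite mul1r => nd.
    (* The fourth power of 5/6 is below 1/2. *)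
    exists (4 * n)%N; rewrite exprM; apply: le_lt_trans nd.
    by rewrite lerXn2r ?nnegrE ?exprn_ge0 ?invr_ge0//; lra.
  (* The inner [n] factors bring the values of [c] together; the outermost one turns this into
     closeness of points, by uniform continuity of [psi]. *)
  exists n.+1 => g [s sF <-]; apply: diameter_lt => // _ _ [x _ <-] [y _ <-].
  rewrite big_ord_recl /=; have [i i3 <-] := sF ord0.
  set w := \big[_/_]_(_ < n) _.
  have cw : `|c (w x) - c (w y)| <= (5 / 6) ^+ n.
    by apply: words; exists (fun j => s (lift ord0 j)).
  apply/ltW/dP; [exact: fr|exact: fr|rewrite farg; apply: le_lt_trans nd].
  by apply: le_trans cw; rewrite ler_piMl// /lam; lra.
- apply/seteqP; split=> // x _; have [s /andP[s0 s1] <-] := psisurj x.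
  have [i [i3 si]] : exists i : nat, (i < 3)%N /\ 0 <= s / lam - i%:R <= 1.
    have [h1|h1] := leP s lam.
      by exists 0%N; split=> //; rewrite subr0 /lam in h1 *; lra.
    have [h2|h2] := leP s (2 * lam).
      by exists 1%N; split=> //; rewrite /lam in h1 h2 *; lra.
    by exists 2%N; split=> //; rewrite /lam in h1 h2 *; lra.
  have [y yE] := csurj _ si; exists (f i); first by exists i.
  exists y => //; rewrite /f yE addrC subrK mulrC divfK// /lam; lra.
Qed.

(** The maps [F i] may coincide, so the family only has some cardinality at most [n]; the least
    cardinality that occurs is then taken. *)
Lemma witnessing_number_le (F : nat -> X -> X) n : witnessing_family [set F i | i in `I_n] ->
  exists m, is_witnessing_number X m /\ (m <= n)%N.
Proof.
move=> wF.
pose P (m : nat) := `[< exists2 F : set (X -> X), witnessing_family F & (F #= `I_m)%card >].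
have [k kn Pk] : exists2 k, (k <= n)%N & P k.
  have [[k Fk] _ _ _] := wF.
  exists k; last by apply/asboolP; exists [set F i | i in `I_n].
  rewrite -card_le_II -(card_le_eql Fk); exact: card_image_le.
have [m Pm mP] := ex_minnP (ex_intro _ k Pk).
exists m; split; last exact: leq_trans (mP k Pk) kn.
split; first exact/asboolP.
by move=> G j wG Gj; apply: mP; apply/asboolP; exists G.
Qed.

End Contraction.

(** * The path through all heights *)

Section Assembly.
Variables (R : realType) (X : metricType R).
Hypothesis cX : compact [set: X].
Hypothesis kX : connected [set: X].
Hypothesis lcX : locally_connected X.
Variables (V : set X) (c : X -> R).
Hypothesis oV : open V.
Hypothesis cV : connected V.
Hypothesis hc : height V c.

Definition tent_height x : R := if `[< V x >] then tent (c x) else 0.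

Lemma tent_heightV x : V x -> tent_height x = tent (c x).
Proof. by move=> Vx; rewrite /tent_height asboolT. Qed.

Lemma tent_height_rest x : rest V c x -> tent_height x = 0.
Proof.
move=> Rx; rewrite /tent_height; case: asboolP => // Vx.
have [c0|c0] := leP (c x) 0; first exact: tent_le0.
have [c1|c1] := leP 1 (c x); first exact: tent_ge1.
by exfalso; apply: Rx; split=> //; rewrite c0.
Qed.

Lemma tent_height_continuous x (e : R) : 0 < e -> exists2 d : R, 0 < d &
  forall y, mdist x y < d -> `|tent_height x - tent_height y| < e.
Proof.
move=> e0; have [_ cC clV _ _] := hc; have [Vx|nVx] := pselect (V x).
  have e2 : 0 < e / 2 by rewrite divr_gt0.
  have [d d0 dP] := cC x _ Vx e2; exists d => // y /dP[Vy xy].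
  rewrite !tent_heightV//; apply: le_lt_trans (tent_lip _ _) _; lra.
have Rx : rest V c x by case=> /nVx.
have [d d0 dP] : exists2 d : R, 0 < d & forall y, mdist x y < d -> rest V c y.
  apply: contrapT => h; apply: nVx; apply: clV; apply/closure_distP => d d0.
  apply: contrapT => hd; apply: h; exists d => // y xy Vy; apply: hd.
  by exists y.
exists d => // y /dP Ry; rewrite !tent_height_rest//.
by rewrite subrr normr0.
Qed.

(** [g t] runs through the fiber from its left to its right limit point for [t] in (0, 1), is a loop
    filling a component of the rest for [t] = 0 and [t] = 1, and is constant beyond, so that
    [concat_paths] applies on the whole line. *)
Lemma height_fractal : exists f : nat -> X -> X, witnessing_family [set f i | i in `I_3].
Proof.
have h01 : 0 < (1 : R) <= 1 by rewrite ltr01 lexx.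
have [x1 _] := from_leftE cX lcX oV hc h01.
have /choice[L LP] (t : R) : exists l, 0 < t <= 1 -> from_left V c t l.
  have [t01|nt] := pselect (0 < t <= 1); last by exists x1.
  by have [l] := from_leftE cX lcX oV hc t01; exists l.
have /choice[r rP] (t : R) : exists r, 0 <= t < 1 -> from_right V c t r.
  have [t01|nt] := pselect (0 <= t < 1); last by exists (L 0).
  by have [r] := from_rightE cX lcX oV hc t01; exists r.
have hr : from_right V c 0 (r 0) by apply: rP; rewrite lexx ltr01.
have hl : from_left V c 1 (L 1) by apply: LP; rewrite lexx ltr01.
have [D DP] := dense_seq cX (L 1).
(* The heights that receive extra time: 0, 1 and the values on a dense sequence. A fiber with
   interior contains some [D n], so at every other height in (0, 1) the fiber is a point. *)
pose td n := if n is n'.+1 then if n' is n''.+1 then c (D n'') else 1 else 0.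
have /choice[g gP] (t : R) : exists g : R -> X,
  [/\ forall e : R, 0 < e -> exists2 d : R, 0 < d &
        forall s t, `|s - t| < d -> mdist (g s) (g t) < e,
      forall s, s <= 0 -> g s = if t <= 0 then r 0 else if t < 1 then L t else L 1,
      forall s, 1 <= s -> g s = if t <= 0 then r 0 else if t < 1 then r t else L 1,
      forall s, if 0 < t < 1 then fiber V c t (g s) else
        rest V c (g s) /\ (t < 0 \/ 1 < t -> g s = g 0) &
      [/\ 0 < t < 1 -> forall x, fiber V c t x -> exists s, g s = x,
          t = 0 -> forall x, connected_component (rest V c) (r 0) x -> exists s, g s = x &
          t = 1 -> forall x, connected_component (rest V c) (L 1) x -> exists s, g s = x]].
  have [t01|nt] := boolP (0 < t < 1).
    have /andP[t0 t1] := t01.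
    have lt : from_left V c t (L t) by apply: LP; rewrite t0 ltW.
    have rt : from_right V c t (r t) by apply: rP; rewrite t1 ltW.
    have [g [g1 g2 g3 g4 g5]] := fiber_path cX kX lcX cV hc t01 lt rt.
    exists g; rewrite leNgt t0 t1/=; split=> //; split=> // tE; move: t0 t1; rewrite tE ?ltxx//.
  have [t0|t0] := ltP t 0.
    exists (fun=> r 0); rewrite (ltW t0); split=> //.
    - by move=> e e0; exists 1 => // *; rewrite mdistxx.
    - by move=> s; split=> //; exact: rest_right hr.
    - by split=> // tE; move: t0; rewrite tE ?ltxx// ltr10.
  have [t1|t1] := ltP 1 t.
    exists (fun=> L 1); rewrite leNgt (lt_trans ltr01 t1) /= ltNge (ltW t1)/=; split=> //.
    - by move=> e e0; exists 1 => // *; rewrite mdistxx.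
    - by move=> s; split=> //; exact: rest_left hl.
    - by split=> // tE; move: t1; rewrite tE ?ltxx// ltr10.
  have [tE|tE] : t = 0 \/ t = 1.
    have [h|h] := leP t 0; first by left; apply/eqP; rewrite eq_le h t0.
    right; apply/eqP; rewrite eq_le t1 leNgt; apply/negP => h'.
    by move: nt; rewrite h h'.
  - have [g [g1 g2 g3 g4 g5]] := rest_path cX lcX hc hr hl (rest_right hr).
    exists g; rewrite tE lexx; split=> //.
      by move=> s; split=> // -[]; rewrite ?ltxx// ltr10.
    by split=> // /esym/eqP; rewrite oner_eq0.
  - have [g [g1 g2 g3 g4 g5]] := rest_path cX lcX hc hr hl (rest_left hl).
    exists g; rewrite tE ler10 ltxx; split=> //.
      by move=> s; split=> // -[]; rewrite ?ltxx// ltr10.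
    by split=> // /eqP; rewrite oner_eq0.
have gL t : g t 0 = if t <= 0 then r 0 else if t < 1 then L t else L 1.
  by have [_ h _ _ _] := gP t; rewrite h.
have gR t : g t 1 = if t <= 0 then r 0 else if t < 1 then r t else L 1.
  by have [_ _ h _ _] := gP t; rewrite h.
have gF (t s : R) : 0 < t < 1 -> fiber V c t (g t s).
  by move=> t01; have [_ _ _ /(_ s) + _] := gP t; rewrite t01.
have gout (t s : R) : t < 0 \/ 1 < t -> g t s = g t 0.
  move=> h; have [_ _ _ /(_ s) + _] := gP t; case: ifP => [/andP[? ?]|_ [_]].
    by exfalso; case: h; lra.
  exact.
(* With a delay of at most 1/4, all heights in [0, 1] are served during [0, 5/4]. *)
have [|||||||psi [v [psi1 psi2 psi3 psi4]]] := @concat_paths R X g td (1 / 4).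
- by rewrite divr_gt0.
- move=> t u e e0; have [/(_ e e0)[d d0 dP] _ _ _ _] := gP t; exists d => // u'; exact: dP.
- by move=> t u u0; rewrite gL; have [_ h _ _ _] := gP t; exact: h.
- by move=> t u u1; rewrite gR; have [_ _ h _ _] := gP t; exact: h.
- move=> t nt u.
  have [t0|t0] := ltP t 0; first by apply: gout; left.
  have [t1|t1] := ltP 1 t; first by apply: gout; right.
  have t01 : 0 < t < 1.
    rewrite !lt_neqAle t0 t1 !andbT; apply/andP; split; apply/eqP.
      by move=> tE; exact: (nt 0%N).
    by move=> tE; exact: (nt 1%N).
  have /andP[t0' t1'] := t01.
  have lt : from_left V c t (L t) by apply: LP; rewrite t0' t1.
  have rt : from_right V c t (r t) by apply: rP; rewrite t1' t0.
  have nint e x : fiber V c t x -> 0 < e -> ~ forall z, mdist x z < e -> fiber V c t z.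
    move=> Fx e0 h; have [n /h[_ cn]] := DP x e e0; exact: (nt n.+2).
  by rewrite !(fiber_singleton kX cV hc t01 lt rt nint (gF _ _ t01)).
- move=> t e e0; rewrite gL.
  have [t0|t0] := leP t 0.
    exists 1 => // t' u _ t't; rewrite gout; last by left; exact: lt_le_trans t't t0.
    by rewrite gL (ltW (lt_le_trans t't t0)) mdistxx.
  have [t1|t1] := ltP 1 t.
    exists (t - 1); first by rewrite subr_gt0.
    move=> t' u; rewrite opprB addrCA subrr addr0 => t'1 t't.
    rewrite gout; last by right.
    by rewrite gL !ifN ?mdistxx// -?leNgt -?ltNge ?ltW// (lt_trans ltr01).
  have [_ _ /(_ e e0)[d d0 dP]] : from_left V c t (L t) by apply: LP; rewrite t0.
  have -> : (if t < 1 then L t else L 1) = L t.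
    by case: ltP => // h; congr L; apply/eqP; rewrite eq_le h t1.
  exists (Num.min d t); first by rewrite lt_min d0.
  move=> t' u; rewrite ltrBlDr -ltrBlDl lt_min => /andP[h1 h2] t't.
  have [Vg cg] : fiber V c t' (g t' u) by apply: gF; lra.
  by apply: dP => //; rewrite cg; lra.
- move=> t e e0; rewrite gR.
  have [t1|t1] := leP 1 t.
    exists 1 => // t' u t't _; rewrite gout; last by right; exact: le_lt_trans t1 t't.
    have t'1 := le_lt_trans t1 t't.
    by rewrite gL !ifN ?mdistxx// -?leNgt -?ltNge ?(ltW t'1)// ?(lt_trans ltr01 t'1)// (lt_le_trans ltr01 t1).
  have [t0|t0] := ltP t 0.
    exists (- t); first by rewrite oppr_gt0.
    move=> t' u t't; rewrite subrr => t'0.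
    rewrite gout; last by left.
    by rewrite gL (ltW t0) (ltW t'0) mdistxx.
  have [_ _ /(_ e e0)[d d0 dP]] : from_right V c t (r t) by apply: rP; rewrite t1 t0.
  have -> : (if t <= 0 then r 0 else r t) = r t.
    by case: leP => // h; congr r; apply/eqP; rewrite eq_le h t0.
  exists (Num.min d (1 - t)); first by rewrite lt_min d0 subr_gt0.
  move=> t' u tt'; rewrite -ltrBlDl lt_min => /andP[h1 h2].
  have [Vg cg] : fiber V c t' (g t' u) by apply: gF; lra.
  by apply: dP => //; rewrite cg; lra.
have cg t u : tent_height (g t u) = tent t.
  have [t0|t0] := leP t 0.
    rewrite (tent_le0 t0); apply: tent_height_rest.
    by have [_ _ _ /(_ u) + _] := gP t; rewrite ltNge t0 => -[].
  have [t1|t1] := leP 1 t.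
    rewrite (tent_ge1 t1); apply: tent_height_rest.
    by have [_ _ _ /(_ u) + _] := gP t; rewrite [t < 1]ltNge t1 andbF => -[].
  have [Vg cg] : fiber V c t (g t u) by apply: gF; rewrite t0.
  by rewrite tent_heightV// cg.
apply: (three_map_fractal psi1 tent_height_continuous).
- by move=> x; rewrite /tent_height; case: asboolP => _; [exact: tent_bound|rewrite lexx ler01].
- by move=> t t01; exists (g (t / 2) 0); rewrite cg tent_half.
- move=> s t; have [u ->] := psi3 s; have [u' ->] := psi3 t; rewrite !cg.
  by apply: le_trans (tent_lip _ _) _; rewrite ler_pM2l.
- move=> x; suff [t [u [t01 <-]]] : exists t u, 0 <= t <= 1 /\ g t u = x.
    by have [s /andP[s0 s1] <-] := psi4 t u; exists s => //; lra.
  have [[Vx cx]|Rx] := pselect (V x /\ 0 < c x < 1).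
    have [_ _ _ _ [/(_ cx x (conj Vx erefl))[u gu] _ _]] := gP (c x).
    by exists (c x), u; split=> //; lra.
  have [Cx|Cx] := rest_component cX kX lcX hc hr hl Rx.
    have [_ _ _ _ [_ /(_ erefl x Cx)[u gu] _]] := gP 0.
    by exists 0, u; rewrite lexx ler01.
  have [_ _ _ _ [_ _ /(_ erefl x Cx)[u gu]]] := gP 1.
  by exists 1, u; rewrite lexx ler01.
Qed.

End Assembly.

Theorem theorem18 (R : realType) (X : metricType R)
    (hX : peano_continuum X)
    (hcut : ~ countable [set x : X | local_cut_point x]) :
  topological_fractal X /\
  exists n : nat, is_witnessing_number X n /\ (n <= 3)%N.
Proof.
have [[_ kX cX] lcX] := hX.
have [y [d [a [b [E [d0 ncE Ed Ecut]]]]]] := uncountable_cuts lcX cX hcut.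
set V := connected_component _ y in Ecut.
have oV : open V := component_open lcX y (open_ball_lt y d).
have cV : connected V := @component_connected _ _ _.
have /choice[A /choice[B AB]] x : exists A B, E x -> cuts V a b x A B.
  have [/Ecut[A [B AB]]|nEx] := pselect (E x); first by exists A, B.
  by exists set0, set0.
have [p [q [Ep Eq pq clV]]] := cut_piece cX lcX d0 Ed AB ncE.
have [Q [e [Q1 Q2 Q3 Q4]]] := dyadic_cuts cX cV AB Ep Eq pq.
have [c hc] := height_exists oV cV AB Ep Eq clV Q1 Q2 Q3 Q4.
have [f fP] := height_fractal cX kX lcX oV cV hc.
split; last exact: witnessing_number_le fP.
by split=> //; exists [set f i | i in `I_3].
Qed.
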